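(* Let $p\in(1,2]$ with dual exponent $q\ge2$ ($1/p+1/q=1$), let $\mathcal{A}$ be the $\ell_p$ unit ball in $\mathbb{R}^d$, $T$ the horizon and $\delta\in(0,1)$. Assume the covariance matrix $\Sigma$ is known. In the stochastic linear bandit with parameter noise model, with probability at least $1-2\delta$ the regret of the VALEE algorithm (context, known-covariance version) is bounded by $\widetilde{O}\big(d+\sqrt{dTq\log(1/\delta)\,\sigma_q^2}\big)$, where $\sigma_q^2=\big(\sum_{i=1}^d\Sigma_{ii}^{q/2}\big)^{2/q}$ and $\widetilde O$ hides logarithmic factors.
   Context: Stochastic linear bandits with parameter noise: fixed unknown distribution $\nu$ on $\mathbb{R}^d$ with mean $\theta^\star$ and covariance $\Sigma$; at each round $t=1,\dots,T$ the learner picks $a_t\in\mathcal{A}$, $\theta_t\sim\nu$ is drawn independently, and the reward $X_t=a_t^\top\theta_t$ is observed; $|a^\top\theta|\le1$ a.s. for all $a\in\mathcal{A}$. Regret $\mathcal{R}_T=\sum_{t=1}^T(a^\star-a_t)^\top\theta^\star$, $a^\star\in\arg\max_{a\in\mathcal{A}}a^\top\theta^\star$. $e_i$ denotes the $i$-th standard basis vector. VALEE (known covariance): set $\hat\sigma_q^2=\sigma_q^2$, $\kappa=\lceil 8\log(d\log(T)/\delta)\rceil$, $\alpha=(d\kappa/(Tq\hat\sigma_q^2))^{1/4}$, $\hat N_0=2$, $\|\hat\theta^{(0)}\|_q=0$. Exploration: for $j=1,2,\dots$ as long as the previous iterate satisfies $\hat N_{j-1}\ge\|\hat\theta^{(j-1)}\|_q$: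 set $\hat N_j=\hat N_{j-1}/2$, $\hat\varepsilon_j=\alpha\sqrt{\hat N_j}$, $T_j(e_i)=\lceil 8/\hat\varepsilon_j^2\rceil$; for $\ell=1,\dots,\kappa$, play each $e_i$ ($i=1,\dots,d$) for $T_j(e_i)$ consecutive rounds and let $\hat\theta^{(j,\ell)}_i$ be the average of the rewards obtained; set $\hat\theta^{(j)}_i=\mathrm{median}_{\ell\le\kappa}\hat\theta^{(j,\ell)}_i$ (median of means). Once $\hat N_j<\|\hat\theta^{(j)}\|_q$, exploit: play for all remaining rounds the action $\hat a$ with $\hat a_i=\mathrm{sign}(\hat\theta^{(j)}_i)|\hat\theta^{(j)}_i|^{q-1}/\|\hat\theta^{(j)}\|_q^{q-1}$. *)

(* Defs.v *)
From HB Require Import structures.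
From mathcomp Require Import all_boot all_order all_algebra.
From mathcomp Require Import all_classical all_reals all_analysis.
Set Implicit Arguments. Unset Strict Implicit. Unset Printing Implicit Defensive.
Import Order.TTheory GRing.Theory Num.Theory.
Local Open Scope ring_scope.
Local Open Scope classical_set_scope.

Definition nat_of_int (z : int) : nat :=
  match z with Posz n => n | Negz _ => 0%N end.

(* order statistic used as "the median": lower median of the sorted list *)
Definition median {R : realType} (s : seq R) : R :=
  nth 0 (sort <=%R s) ((size s).-1./2).

Section Vectors.
Context {R : realType} (d : nat).

Definition dotv (a b : 'I_d -> R) : R := \sum_(i < d) a i * b i.

Definition lpnorm (r : R) (v : 'I_d -> R) : R :=
  (\sum_(i < d) `|v i| `^ r) `^ (r^-1).

Definition basis (k : nat) : 'I_d -> R := fun i => if (i : nat) == k then 1 else 0.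

Definition sigma_q2 (q : R) (Sigma : 'M[R]_d) : R :=
  (\sum_(i < d) Sigma i i `^ (q / 2)) `^ (2 / q).

End Vectors.

(* VALEE, known-covariance version, as a deterministic function of the *)
(* realized parameter sequence theta_t (rounds are 0-indexed: t < T).  *)
(* s2 is the (known) value sigma_q^2 used as hat sigma_q^2.            *)
Section VALEE.
Context {R : realType} (d T : nat) (delta q s2 : R) (theta : nat -> 'I_d -> R).

Definition kappa : nat :=
  nat_of_int (Num.ceil (8 * ln (d%:R * ln T%:R / delta))).

Definition alpha : R := (d%:R * kappa%:R / (T%:R * q * s2)) `^ (4^-1).

Definition Nhat (j : nat) : R := 2 / 2 ^+ j.

Definition epshat (j : nat) : R := alpha * Num.sqrt (Nhat j).

Definition Tj (j : nat) : nat := nat_of_int (Num.ceil (8 / epshat j ^+ 2)).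

Definition phase_len (j : nat) : nat := (kappa * d * Tj j)%N.

Definition phase_start (j : nat) : nat := (\sum_(1 <= k < j) phase_len k)%N.

Definition reward (a : 'I_d -> R) (t : nat) : R := dotv a (theta t).

(* within phase j, for l = 0..kappa-1, for i = 0..d-1, e_i is played for
   T_j consecutive rounds; hat theta^(j,l)_i = mean of those rewards *)
Definition mean_est (j l i : nat) : R :=
  (Tj j)%:R^-1 * \sum_(r < Tj j)
     reward ((@basis R d i)) (phase_start j + (l * d + i) * Tj j + r)%N.

Definition thetahat (j : nat) : 'I_d -> R :=
  fun i => median [seq mean_est j l i | l <- iota 0 kappa].

Definition stops (j : nat) : bool := Nhat j < lpnorm q (thetahat j).

Definition exploit_action (v : 'I_d -> R) : 'I_d -> R :=
  fun i => Num.sg (v i) * `|v i| `^ (q - 1) / lpnorm q v `^ (q - 1).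

Definition phase_of (t : nat) : nat :=
  head 1%N [seq j <- iota 1 t.+1 | (t < phase_start j.+1)%N].

Definition explore_action (t : nat) : 'I_d -> R :=
  let j := phase_of t in
  @basis R d (((t - phase_start j) %/ Tj j) %% d)%N.

(* action at round t: if the first stopping phase J has been completed
   before t, exploit with hat theta^(J); otherwise follow the schedule *)
Definition valee_action (t : nat) : 'I_d -> R :=
  match [seq j <- iota 1 t | stops j && (phase_start j.+1 <= t)%N] with
  | j :: _ => exploit_action (thetahat j)
  | [::] => explore_action t
  end.

End VALEE.

Definition valee_regret {R : realType} (d T : nat) (delta q s2 : R)
  (theta : nat -> 'I_d -> R) (astar thetastar : 'I_d -> R) : R :=
  \sum_(t < T) (dotv astar thetastar
                - dotv (@valee_action R d T delta q s2 theta t) thetastar).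

(* i.i.d. random vectors theta_t : Omega -> R^d (given coordinatewise) *)
(* Laws/independence are expressed on measurable rectangles, which     *)
(* generate the Borel sigma-algebra of R^d (a pi-system).              *)
Definition rect_event {R : realType} {dO} {Omega : measurableType dO} (d : nat)
  (X : 'I_d -> Omega -> R) (B : 'I_d -> set R) : set Omega :=
  [set w | forall i, B i (X i w)].

Definition iid_vectors {R : realType} {dO} {Omega : measurableType dO} (d : nat)
  (P : probability Omega R) (X : nat -> 'I_d -> Omega -> R) : Prop :=
  (forall (t : nat) (B : 'I_d -> set R), (forall i, measurable (B i)) ->
     P (rect_event (X t) B) = P (rect_event (X 0%N) B)) /\
  (forall (S : seq nat) (B : nat -> 'I_d -> set R), uniq S ->
     (forall t i, measurable (B t i)) ->
     P [set w | forall t, t \in S -> rect_event (X t) (B t) w]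
       = (\prod_(t <- S) P (rect_event (X t) (B t)))%E).

(* Main.v *)
Require Import Defs.
From HB Require Import structures.
From mathcomp Require Import all_boot all_order all_algebra.
From mathcomp Require Import all_classical all_reals all_analysis.
From mathcomp Require Import measurable_realfun ring lra zify.
Set Implicit Arguments. Unset Strict Implicit. Unset Printing Implicit Defensive.
Import Order.TTheory GRing.Theory Num.Theory.
Local Open Scope ring_scope.
Local Open Scope classical_set_scope.

(** Write c = alpha sigma_q, x_j = 8 / (alpha^2 N_j), and let J be the phase of the last round.

    Each coordinate of the estimate of phase j < J is a median of kappa independent means of
    T_j >= max(1, x_j) rewards, so Chebyshev's inequality and a union bound over the sets of
    half of the means make it miss by more than eps_j sqrt(Sigma_ii) with probability at most
    2^(-kappa/2) min(1, x_j).  The number of phases is not logarithmic when sigma_q is tiny,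
    but the x_j double from phase to phase, and min(1, x) <= 4 (ln(1 + 2x) - ln(1 + x))
    telescopes, so the min(1, x_j) add up to O(ln T).

    When no estimate misses, the estimate of phase j is within c sqrt(N_j) of theta* in l_q.
    A round explored in phase j then costs O(||theta*||_q) = O(N_j + c^2), because phase j - 1
    did not stop, and the same telescoping sums these costs.  Exploitation costs O(q c^2) per
    round: the dual action of an estimate x has gap O(q) ||theta* - x||_q^2 / ||x||_q since
    the duality map of l_q is Lipschitz of constant O(q) on the unit sphere. *)

(* Scalar powers and the signed power function *)
Local Opaque powR.

Lemma powR_div {R : realType} (x y r : R) : 0 <= x -> 0 < y ->
  (x / y) `^ r = x `^ r / y `^ r.
Proof.
move=> x0 y0; rewrite powRM ?invr_ge0 ?(ltW y0)//; congr (_ * _).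
by rewrite -powR_inv1 ?(ltW y0)// -powRrM mulN1r powRN.
Qed.

Section ScalarPowers.
Context {R : realType}.

(** Young's inequality for the product of [t] and 1, with exponents r and r / (r - 1), multiplied by
    r. *)
Lemma bernoulli_powR (t r : R) : 0 <= t -> 1 <= r -> 1 + r * (t - 1) <= t `^ r.
Proof.
move=> t0; rewrite le_eqVlt => /predU1P[<-|r1]; first by rewrite powRr1//; lra.
have r0 : 0 < r by rewrite (lt_trans _ r1).
have rr : r^-1 + ((1 - r^-1)^-1)^-1 = 1 by rewrite invrK addrC subrK.
have := @conjugate_powR R t 1 r (1 - r^-1)^-1 t0 ler01 r0 _ rr.
rewrite invr_gt0 subr_gt0 invf_lt1// => /(_ r1).
rewrite powR1 mulr1 invrK mul1r -(ler_pM2r r0) mulrDl divfK ?gt_eqF//.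
rewrite mulrBl mulVf ?gt_eqF//; lra.
Qed.

(** Bernoulli at y / x, scaled by x ^ r: the convex power lies above its tangent at the larger point
    [x]. *)
Lemma powRB_le (x y r : R) : 0 <= y <= x -> 1 <= r ->
  x `^ r - y `^ r <= r * (x - y) * x `^ (r - 1).
Proof.
move=> /andP[y0 yx] r1.
have r0 : 0 < r by rewrite (lt_le_trans _ r1).
have [x0|x0] := ltrP 0 x; last first.
  have -> : x = 0 by apply/eqP; rewrite eq_le x0 (le_trans y0 yx).
  have -> : y = 0 by apply/eqP; rewrite eq_le y0 (le_trans yx x0).
  by rewrite !subrr mulr0 mul0r.
have := @bernoulli_powR (y / x) r (divr_ge0 y0 (ltW x0)) r1.
rewrite powR_div// ler_pdivlMr ?powR_gt0// -(@mulr_powRB1 _ x r) ?(ltW x0)//.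
set z := x `^ (r - 1).
have -> : (1 + r * (y / x - 1)) * (x * z) = x * z - r * (x - y) * z.
  by field; rewrite gt_eqF.
lra.
Qed.

(** The odd extension of the power. For r = q - 1 it acts coordinatewise as the duality map of the
    unit sphere of l_q. *)
Definition spow (r z : R) : R := Num.sg z * `|z| `^ r.

(** Oddness and symmetry leave two cases. For equal signs this is [powRB_le]; for opposite signs |x
    - y| = |x| + |y|, and each power splits off one factor, the remaining one being at most the
    maximum. *)
Lemma spow_lip (x y r : R) : 1 <= r ->
  `|spow r x - spow r y| <= r * `|x - y| * Num.max `|x| `|y| `^ (r - 1).
Proof.
move=> r1; have r0 : 0 < r by rewrite (lt_le_trans _ r1).
have spowN z : spow r (- z) = - spow r z by rewrite /spow sgrN normrN mulNr.
have spow0 z : 0 <= z -> spow r z = z `^ r.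
  rewrite le_eqVlt => /predU1P[<-|z0]; first by rewrite /spow sgr0 mul0r powR0 ?gt_eqF.
  by rewrite /spow gtr0_sg// mul1r gtr0_norm.
have pos a b : 0 <= b -> b <= a ->
    `|spow r a - spow r b| <= r * `|a - b| * Num.max `|a| `|b| `^ (r - 1).
  move=> b0 ba; have a0 := le_trans b0 ba.
  rewrite !spow0// !ger0_norm ?subr_ge0 ?ge0_ler_powR ?nnegrE ?(ltW r0)//.
  by rewrite max_l// powRB_le ?b0.
have opp a b : 0 <= a -> b <= 0 ->
    `|spow r a - spow r b| <= r * `|a - b| * Num.max `|a| `|b| `^ (r - 1).
  move=> a0 b0; have -> : b = - (- b) by rewrite opprK.
  have : 0 <= - b by rewrite oppr_ge0.
  move: (- b) => {b b0} b b0.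
  rewrite spowN !opprK normrN !spow0// !ger0_norm ?addr_ge0 ?powR_ge0//.
  rewrite -(@mulr_powRB1 _ a r)// -(@mulr_powRB1 _ b r)//.
  have r10 : 0 <= r - 1 by rewrite subr_ge0.
  apply: (@le_trans _ _ ((a + b) * Num.max a b `^ (r - 1))).
    rewrite mulrDl lerD// ler_wpM2l// ge0_ler_powR ?nnegrE// ?le_max ?lexx ?orbT ?a0 ?b0//.
  by rewrite ler_wpM2r ?powR_ge0// ler_peMl ?addr_ge0.
have sym a b : `|spow r a - spow r b| <= r * `|a - b| * Num.max `|a| `|b| `^ (r - 1) ->
    `|spow r b - spow r a| <= r * `|b - a| * Num.max `|b| `|a| `^ (r - 1).
  by rewrite distrC [`|a - b|]distrC maxC.
have neg a b : `|spow r (- a) - spow r (- b)| <=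
      r * `|- a - - b| * Num.max `|- a| `|- b| `^ (r - 1) ->
    `|spow r a - spow r b| <= r * `|a - b| * Num.max `|a| `|b| `^ (r - 1).
  by rewrite !spowN -!opprD !normrN.
case/orP: (le_total 0 x) => x0; case/orP: (le_total 0 y) => y0.
- by case/orP: (le_total x y) => xy; [apply: sym|]; exact: pos.
- exact: opp.
- by apply: sym; exact: opp.
- by apply: neg; case/orP: (le_total x y) => xy; [|apply: sym]; apply: pos;
    rewrite ?oppr_ge0 ?lerN2.
Qed.

Lemma spowZ (r c z : R) : 0 < c -> spow r (z / c) = spow r z / c `^ r.
Proof.
move=> c0; rewrite /spow sgrM sgrV (gtr0_sg c0) mulr1 normrM normfV.
by rewrite (gtr0_norm c0) powR_div// mulrA.
Qed.

(** Replacing every factor by the largest of the three numbers gives its q-th power, which is one of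
    the summands on the right. *)
Lemma mul_powR_le (x y z q : R) : 0 <= x -> 0 <= y -> 0 <= z -> 2 <= q ->
  x * y * z `^ (q - 2) <= x `^ q + y `^ q + z `^ q.
Proof.
move=> x0 y0 z0 q2.
have q0 : 0 <= q - 2 by rewrite subr_ge0.
have le M : x <= M -> y <= M -> z <= M -> x * y * z `^ (q - 2) <= M `^ q.
  move=> xM yM zM; have M0 : 0 <= M by rewrite (le_trans x0).
  have [M0'|M1] := eqVneq M 0.
    suff -> : x = 0 by rewrite mul0r mul0r powR_ge0.
    by apply/eqP; rewrite eq_le x0 -M0' xM.
  have -> : M `^ q = M * M * M `^ (q - 2).
    rewrite powRB ?M1 ?implybT// powR_mulrn// expr2 mulrC divfK//.
    by rewrite mulf_neq0.
  rewrite ler_pM ?mulr_ge0 ?powR_ge0 ?ler_pM//.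
  by rewrite ge0_ler_powR ?nnegrE.
have [xy|/ltW xy] := lerP x y.
- have [yz|/ltW yz] := lerP y z.
  + apply: (le_trans (le z (le_trans xy yz) yz (lexx _))).
    by rewrite lerDr addr_ge0 ?powR_ge0.
  + apply: (le_trans (le y xy (lexx _) yz)).
    by rewrite addrAC lerDr addr_ge0 ?powR_ge0.
- have [xz|/ltW xz] := lerP x z.
  + apply: (le_trans (le z xz (le_trans xy xz) (lexx _))).
    by rewrite lerDr addr_ge0 ?powR_ge0.
  + apply: (le_trans (le x (lexx _) xy xz)).
    by rewrite -addrA lerDl addr_ge0 ?powR_ge0.
Qed.

End ScalarPowers.

(** * Norms of l_p, Hoelder duality and the gap of the dual action *)

Section LpNorm.
Context {R : realType} {d : nat}.
Implicit Types (v u a b : 'I_d -> R) (r p q : R).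

Lemma lpnorm_ge0 r v : 0 <= lpnorm r v.
Proof. exact: powR_ge0. Qed.

Lemma lpnorm_gt0 r v : lpnorm r v != 0 -> 0 < lpnorm r v.
Proof. by rewrite lt0r lpnorm_ge0 andbT. Qed.

Lemma sum_norm_powR_ge0 r v : 0 <= \sum_(i < d) `|v i| `^ r.
Proof. by apply: sumr_ge0 => i _; exact: powR_ge0. Qed.

Lemma lpnorm_powR r v : r != 0 -> lpnorm r v `^ r = \sum_(i < d) `|v i| `^ r.
Proof.
by move=> r0; rewrite /lpnorm -powRrM mulVf// powRr1// sum_norm_powR_ge0.
Qed.

Lemma lpnorm_eq0 r v : lpnorm r v = 0 -> forall i, v i = 0.
Proof.
move=> /powR_eq0_eq0/eqP; rewrite psumr_eq0 => [/allP h i|i _]; last exact: powR_ge0.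
have := h i (mem_index_enum i); rewrite implyTb => /eqP/powR_eq0_eq0/eqP.
by rewrite normr_eq0 => /eqP.
Qed.

Lemma lpnormZ r (c : R) v : 0 < r -> lpnorm r (fun i => c * v i) = `|c| * lpnorm r v.
Proof.
move=> r0; rewrite /lpnorm.
under eq_bigr do rewrite normrM powRM//.
rewrite -mulr_sumr powRM ?powR_ge0 ?sum_norm_powR_ge0//.
by rewrite -powRrM mulfV ?gt_eqF// powRr1.
Qed.

Lemma ler_lpnorm r u v : 0 < r -> (forall i, `|u i| <= `|v i|) -> lpnorm r u <= lpnorm r v.
Proof.
move=> r0 uv; rewrite /lpnorm ge0_ler_powR ?invr_ge0 ?nnegrE ?sum_norm_powR_ge0 ?(ltW r0)//.
by apply: ler_sum => i _; rewrite ge0_ler_powR ?nnegrE ?(ltW r0).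
Qed.

Lemma sum_norm_powR_normalized r v : 0 < r -> lpnorm r v != 0 ->
  \sum_(i < d) (`|v i| / lpnorm r v) `^ r = 1.
Proof.
move=> r0 v0.
under eq_bigr do rewrite powRM ?invr_ge0 ?lpnorm_ge0//.
rewrite -mulr_suml -lpnorm_powR ?gt_eqF// -powRM ?lpnorm_ge0 ?invr_ge0 ?lpnorm_ge0//.
by rewrite mulfV// powR1.
Qed.

Lemma lpnorm_basis r (k : nat) : r != 0 -> (k < d)%N -> lpnorm r (@Defs.basis R d k) = 1.
Proof.
move=> r0 kd; rewrite /lpnorm (bigD1 (Ordinal kd))//= big1 ?addr0.
  by rewrite /Defs.basis/= eqxx normr1 !powR1.
move=> i ik; rewrite /Defs.basis ifF ?normr0 ?powR0//.
by apply: contraNF ik => /eqP ik; apply/eqP/val_inj.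
Qed.

Lemma dotv_basis v (i : 'I_d) : dotv (@Defs.basis R d i) v = v i.
Proof.
rewrite /dotv (bigD1 i)//= /Defs.basis eqxx mul1r big1 ?addr0// => j ji.
by rewrite ifF ?mul0r//; apply: contraNF ji => /eqP ji; apply/eqP/val_inj.
Qed.

Lemma hoelder_dotv p q a b : 0 < p -> 0 < q -> p^-1 + q^-1 = 1 ->
  dotv a b <= lpnorm p a * lpnorm q b.
Proof.
move=> p0 q0 pq.
have [/lpnorm_eq0 a0|a0] := eqVneq (lpnorm p a) 0.
  by rewrite /dotv big1 ?mulr_ge0 ?lpnorm_ge0// => i _; rewrite a0 mul0r.
have [/lpnorm_eq0 b0|b0] := eqVneq (lpnorm q b) 0.
  by rewrite /dotv big1 ?mulr_ge0 ?lpnorm_ge0// => i _; rewrite b0 mulr0.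
have ab0 : 0 < lpnorm p a * lpnorm q b by apply: mulr_gt0; exact: lpnorm_gt0.
rewrite -[leRHS]mul1r -ler_pdivrMr// /dotv mulr_suml.
apply: (@le_trans _ _ (\sum_(i < d) ((`|a i| / lpnorm p a) `^ p / p +
   (`|b i| / lpnorm q b) `^ q / q))).
  apply: ler_sum => i _; apply: le_trans (conjugate_powR _ _ _ _ _) => //.
  - by rewrite mulf_div ler_wpM2r ?invr_ge0 ?(ltW ab0)// -normrM ler_norm.
  - by rewrite divr_ge0 ?lpnorm_ge0.
  - by rewrite divr_ge0 ?lpnorm_ge0.
have sum_le1 (F G : 'I_d -> R) : \sum_(i < d) F i = 1 -> \sum_(i < d) G i = 1 ->
    \sum_(i < d) (F i / p + G i / q) <= 1.
  by move=> F1 G1; rewrite big_split/= -!mulr_suml F1 G1 !mul1r pq.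
apply: sum_le1; exact: sum_norm_powR_normalized.
Qed.

Lemma lpnormN r v : lpnorm r (fun i => - v i) = lpnorm r v.
Proof. by rewrite /lpnorm; under eq_bigr do rewrite normrN. Qed.

Lemma dotvN a b : dotv (fun i => - a i) b = - dotv a b.
Proof. by rewrite /dotv -sumrN; apply: eq_bigr => i _; rewrite mulNr. Qed.

Lemma dotvBr a u v : dotv a (fun i => u i - v i) = dotv a u - dotv a v.
Proof. by rewrite /dotv -sumrB; apply: eq_bigr => i _; rewrite mulrBr. Qed.

Lemma dotvDr a u v : dotv a (fun i => u i + v i) = dotv a u + dotv a v.
Proof. by rewrite /dotv -big_split; apply: eq_bigr => i _; rewrite mulrDr. Qed.

Lemma dotvBl a u v : dotv (fun i => u i - v i) a = dotv u a - dotv v a.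
Proof. by rewrite /dotv -sumrB; apply: eq_bigr => i _; rewrite mulrBl. Qed.

Lemma exploit_actionE q v i : lpnorm q v != 0 ->
  exploit_action q v i = spow (q - 1) (v i / lpnorm q v).
Proof. by move=> v0; rewrite (spowZ _ _ (lpnorm_gt0 v0)) /exploit_action /spow. Qed.

Lemma norm_exploit_action q v i :
  `|exploit_action q v i| = `|v i| `^ (q - 1) / lpnorm q v `^ (q - 1) * (v i != 0)%:R.
Proof.
rewrite /exploit_action normrM normrM normr_sg normfV.
rewrite (ger0_norm (powR_ge0 _ _)) (ger0_norm (powR_ge0 _ _)).
by rewrite -mulrA mulrC.
Qed.

Lemma lpnorm_exploit_action p q v : 1 < q -> p^-1 + q^-1 = 1 -> lpnorm q v != 0 ->
  lpnorm p (exploit_action q v) = 1.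
Proof.
move=> q1 pq v0.
have q0 : 0 < q by rewrite (lt_trans _ q1).
have p0 : 0 < p.
  by rewrite -invr_gt0 (_ : p^-1 = 1 - q^-1) ?subr_gt0 ?invf_lt1// -pq addrK.
have qp : (q - 1) * p = q.
  have pE : p = (1 - q^-1)^-1 by rewrite -pq addrK invrK.
  rewrite pE; field; rewrite gt_eqF//= subr_eq0 gt_eqF//.
rewrite {1}/lpnorm (_ : \sum_(i < d) _ = 1) ?powR1//.
rewrite -(@sum_norm_powR_normalized q v q0 v0); apply: eq_bigr => i _.
rewrite norm_exploit_action; have N0 := lpnorm_gt0 v0; move: N0.
move: (lpnorm q v) => N N0.
have [->|vi0] := eqVneq (v i) 0.
  by rewrite mulr0 normr0 mul0r !powR0 ?gt_eqF.
by rewrite mulr1 -powR_div// -powRrM qp.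
Qed.

Lemma dotv_exploit_action q v : 1 < q -> lpnorm q v != 0 ->
  dotv (exploit_action q v) v = lpnorm q v.
Proof.
move=> q1 v0; have q0 : 0 < q by rewrite (lt_trans _ q1).
have := @lpnorm_powR q v (lt0r_neq0 q0); rewrite /dotv /exploit_action.
have N0 := lpnorm_gt0 v0; move: N0; move: (lpnorm q v) => N N0.
rewrite -mulr_powRB1 ?(ltW N0)// => NE.
have Np : 0 < N `^ (q - 1) by exact: powR_gt0.
apply: (mulIf (lt0r_neq0 Np)); rewrite NE mulr_suml; apply: eq_bigr => i _.
rewrite -(@mulr_powRB1 _ `|v i| q)// [X in _ = X * _]normrEsg.
move: (lt0r_neq0 Np); move: (N `^ (q - 1)) => z z0; by field.
Qed.

(** Minkowski by duality: the dual action of u + v attains the norm of the sum, and by Hoelder it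
    pairs with [u] and with [v] to at most their norms. *)
Lemma lpnormD p q u v : 1 < q -> p^-1 + q^-1 = 1 ->
  lpnorm q (fun i => u i + v i) <= lpnorm q u + lpnorm q v.
Proof.
move=> q1 pq; have q0 : 0 < q by rewrite (lt_trans _ q1).
have p0 : 0 < p.
  by rewrite -invr_gt0 (_ : p^-1 = 1 - q^-1) ?subr_gt0 ?invf_lt1// -pq addrK.
have [->|uv0] := eqVneq (lpnorm q (fun i => u i + v i)) 0.
  by rewrite addr_ge0 ?lpnorm_ge0.
rewrite -dotv_exploit_action// dotvDr.
have le w : dotv (exploit_action q (fun i => u i + v i)) w <= lpnorm q w.
  have := hoelder_dotv (exploit_action q (fun i => u i + v i)) w p0 q0 pq.
  by rewrite (lpnorm_exploit_action q1 pq uv0) mul1r.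
exact: lerD.
Qed.

(** After normalizing [u] and [v], [mul_powR_le] bounds each term by three q-th powers, which sum to
    at most 1 + 1 + 2. *)
Lemma sum_mul_powR_le q u v (m : 'I_d -> R) : 2 <= q -> (forall i, 0 <= m i) ->
  \sum_(i < d) m i `^ q <= 2 ->
  \sum_(i < d) `|u i| * `|v i| * m i `^ (q - 2) <= 4 * (lpnorm q u * lpnorm q v).
Proof.
move=> q2 m0 m2; have q0 : 0 < q by rewrite (lt_le_trans _ q2).
have [u0|u0] := eqVneq (lpnorm q u) 0.
  rewrite big1 ?mulr_ge0 ?lpnorm_ge0// => i _.
  by rewrite (lpnorm_eq0 u0) normr0 !mul0r.
have [v0|v0] := eqVneq (lpnorm q v) 0.
  rewrite big1 ?mulr_ge0 ?lpnorm_ge0// => i _.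
  by rewrite (lpnorm_eq0 v0) normr0 mulr0 mul0r.
have Su := sum_norm_powR_normalized q0 u0; have Sv := sum_norm_powR_normalized q0 v0.
move: (lpnorm_gt0 u0) (lpnorm_gt0 v0) Su Sv.
move: (lpnorm q u) (lpnorm q v) => U V U0 V0 Su Sv.
have UV : 0 < U * V by rewrite mulr_gt0.
rewrite -ler_pdivrMr// mulr_suml.
apply: (@le_trans _ _ (\sum_(i < d) ((`|u i| / U) `^ q + (`|v i| / V) `^ q + m i `^ q))).
  apply: ler_sum => i _.
  have := @mul_powR_le R (`|u i| / U) (`|v i| / V) (m i) q _ _ (m0 i) q2.
  rewrite !divr_ge0 ?(ltW U0) ?(ltW V0)// => /(_ isT isT); apply: le_trans.
  by rewrite mulf_div mulrAC.
rewrite big_split/= big_split/= Su Sv; move: m2.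
by move: (\sum_(i < d) _) => S; clear; lra.
Qed.

(** With U and V the two norms, the difference is (v - u) / U - ((V - U) / (U V)) v. Each of the two
    parts has norm at most that of v - u divided by U, since |V - U| is at most the norm of v -
    u. *)
Lemma lpnorm_normalizedB p q u v : 1 < q -> p^-1 + q^-1 = 1 ->
  lpnorm q u != 0 -> lpnorm q v != 0 ->
  lpnorm q (fun i => v i / lpnorm q v - u i / lpnorm q u) <=
  2 * lpnorm q (fun i => v i - u i) / lpnorm q u.
Proof.
move=> q1 pq /lpnorm_gt0 u0 /lpnorm_gt0 v0.
have q0 : 0 < q by rewrite (lt_trans _ q1).
set U := lpnorm q u; set V := lpnorm q v; set h := lpnorm q (fun i => v i - u i).
rewrite -/U in u0 *; rewrite -/V in v0 *.
have UV : `|V - U| <= h.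
  have e1 : v = (fun i => u i + (v i - u i)) by apply/funext => i; rewrite addrC subrK.
  have e2 : u = (fun i => v i + - (v i - u i)) by apply/funext => i; rewrite opprB addrC subrK.
  have := lpnormD u (fun i => v i - u i) q1 pq; rewrite -e1 -/U -/V -/h => VU.
  have := lpnormD v (fun i => - (v i - u i)) q1 pq; rewrite -e2 lpnormN -/U -/V -/h => UV.
  move: VU UV; clear; clearbody U V h; rewrite ler_norml; lra.
have -> : (fun i => v i / V - u i / U) =
    (fun i => U^-1 * (v i - u i) + - ((V - U) / (U * V)) * v i).
  apply/funext => i; clearbody U V; move: (u i) (v i) => x y.
  by field; rewrite !gt_eqF.
apply: (le_trans (lpnormD _ _ q1 pq)).
rewrite (lpnormZ _ _ q0) (lpnormZ _ _ q0) -/h -/V normrN normfV (gtr0_norm u0).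
clearbody U V h.
have -> : `|(V - U) / (U * V)| * V = `|V - U| / U.
  rewrite normrM normfV (gtr0_norm (mulr_gt0 u0 v0)).
  by field; rewrite !gt_eqF.
by rewrite mulrC -mulrDl ler_pM2r ?invr_gt0// mulrDl mul1r lerD2l.
Qed.

(* With a and b the dual actions of u and v, the gap is b.v - a.v = (b - a).(v - u) + (b.u - a.u),
   whose last term is nonpositive by Hoelder's inequality; b - a is bounded coordinatewise by
   spow_lip. *)
Lemma dual_gap_le p q u v : 2 <= q -> p^-1 + q^-1 = 1 -> lpnorm q u != 0 ->
  lpnorm q v - dotv (exploit_action q u) v <=
  8 * (q - 1) * lpnorm q (fun i => v i - u i) ^+ 2 / lpnorm q u.
Proof.
have sub11 (z : R) : z - 1 - 1 = z - 2 by clear; ring.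
have le1B1 (z : R) : 2 <= z -> 1 <= z - 1 by clear; lra.
have absdiv (x y : R) : 0 < y -> `|x / y| = `|x| / y.
  by move=> y0; rewrite normrM normfV (gtr0_norm y0).
have max_powR_le (x y : R) : Num.max x y `^ q <= x `^ q + y `^ q.
  by rewrite /Num.max; case: ifP => _; rewrite ?lerDl ?lerDr powR_ge0.
have mulACA_le (x y z t : R) : x * y * z * t <= x * (y * t * z).
  by rewrite mulrAC !mulrA.
move=> q2 pq u0.
have q1 : 1 < q by rewrite (lt_le_trans _ q2)// ltr1n.
have q0 : 0 < q by rewrite (lt_trans _ q1).
have p0 : 0 < p.
  by rewrite -invr_gt0 (_ : p^-1 = 1 - q^-1) ?subr_gt0 ?invf_lt1// -pq addrK.
have U0 := lpnorm_gt0 u0.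
have [v0|v0] := eqVneq (lpnorm q v) 0.
  rewrite v0 /dotv big1 ?subrr.
    by rewrite divr_ge0 ?lpnorm_ge0// !mulr_ge0 ?exprn_ge0 ?lpnorm_ge0// subr_ge0 ltW.
  by move=> i _; rewrite (lpnorm_eq0 v0) mulr0.
have V0 := lpnorm_gt0 v0.
set a := exploit_action q u; set b := exploit_action q v.
have bu : dotv b u <= lpnorm q u.
  have := hoelder_dotv b u p0 q0 pq.
  by rewrite (lpnorm_exploit_action q1 pq v0) mul1r.
have au : dotv a u = lpnorm q u := dotv_exploit_action q1 u0.
have bv : dotv b v = lpnorm q v := dotv_exploit_action q1 v0.
have aE i : a i = spow (q - 1) (u i / lpnorm q u) by exact: exploit_actionE.
have bE i : b i = spow (q - 1) (v i / lpnorm q v) by exact: exploit_actionE.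
have Su := sum_norm_powR_normalized q0 u0; have Sv := sum_norm_powR_normalized q0 v0.
have Hw := lpnorm_normalizedB q1 pq u0 v0.
rewrite -bv; move: U0 V0 bu au bv aE bE Su Sv Hw.
move: (lpnorm q u) (lpnorm q v) {u0 v0} => U V U0 V0 bu au bv aE bE Su Sv Hw.
clearbody a b.
apply: (@le_trans _ _ (dotv (fun i => b i - a i) (fun i => v i - u i))).
  rewrite dotvBl dotvBr dotvBr au; move: bu.
  by move: (dotv b u) (dotv b v) (dotv a v); clear => ? ? ?; lra.
pose w i := v i / V - u i / U.
(* By [spow_lip] the coordinates of b - a carry the factor [m i] to the power q - 2. As the larger
   entry of two unit vectors, [m] has q-th powers summing to at most 2, as [sum_mul_powR_le]
   requires. *)
pose m i := Num.max `|v i / V| `|u i / U|.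
rewrite -/w in Hw.
apply: (@le_trans _ _ ((q - 1) * \sum_(i < d) `|w i| * `|v i - u i| * m i `^ (q - 2))).
  rewrite /dotv mulr_sumr; apply: ler_sum => i _.
  apply: (le_trans (ler_norm _)); rewrite normrM.
  have := @spow_lip R (v i / V) (u i / U) (q - 1) (le1B1 _ q2).
  rewrite sub11 -/(m i) -aE -bE => H.
  apply: (le_trans (ler_wpM2r (normr_ge0 _) H)).
  exact: mulACA_le.
have m2 : \sum_(i < d) m i `^ q <= 2.
  apply: (@le_trans _ _ (\sum_(i < d) ((`|v i| / V) `^ q + (`|u i| / U) `^ q))).
    apply: ler_sum => i _; rewrite /m -(absdiv _ _ V0) -(absdiv _ _ U0).
    exact: max_powR_le.
  by rewrite big_split/= Sv Su.
have m0 i : 0 <= m i by rewrite /m le_max normr_ge0.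
have := sum_mul_powR_le w (fun i => v i - u i) q2 m0 m2.
move: Hw; move: (\sum_(i < d) _) => S.
have := lpnorm_ge0 q (fun i => v i - u i).
move: (lpnorm q (fun i => v i - u i)) (lpnorm q w) => h W h0 Hw HS.
have q10 : 0 <= q - 1 by rewrite subr_ge0 ltW.
apply: (le_trans (ler_wpM2l q10 HS)).
rewrite (_ : 8 * (q - 1) * h ^+ 2 / U = (q - 1) * (4 * (2 * h / U * h))).
  by rewrite ler_wpM2l// ler_wpM2l// ler_wpM2r.
by move: (lt0r_neq0 U0); clear => U0; field.
Qed.

End LpNorm.

(** * Expectation of a product of independent variables *)

Section Independence.
Context {R : realType} {dO : measure_display} {Omega : measurableType dO}.
Variable P : probability Omega R.

Lemma Lfun2_ae_bounded (f : Omega -> R) (M : R) : measurable_fun setT f ->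
  {ae P, forall w, `|f w| <= M} -> f \in Lfun P 2%:E.
Proof.
move=> mf fM; rewrite inE; apply/andP; split; rewrite inE//=.
rewrite /finite_norm unlock poweR_lty//=.
apply: (@le_lt_trans _ _ (\int[P]_x (M ^+ 2)%:E)%E); last first.
  by rewrite integral_cst//= probability_setT mule1 ltry.
apply: ae_ge0_le_integral => //.
- apply/measurable_EFinP.
  apply: (measurableT_comp (measurable_powR _)) => //.
  exact: measurableT_comp.
- by move=> x _; rewrite lee_fin sqr_ge0.
- apply: filterS fM => x xM _ /=; rewrite lee_fin powR_mulrn//.
  by rewrite ler_sqr ?nnegrE// (le_trans _ xM).
Qed.

(** The law of the pair and the product of the two laws agree on rectangles, hence everywhere;
    Fubini then separates the integral of the product. *)
Lemma expectationM_indep (X Y : {RV P >-> R}) :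
  (X : Omega -> R) \in Lfun P 1 -> (Y : Omega -> R) \in Lfun P 1 ->
  (X \* Y)%R \in Lfun P 1 ->
  (forall A B : set R, measurable A -> measurable B ->
     P (X @^-1` A `&` Y @^-1` B) = P (X @^-1` A) * P (Y @^-1` B))%E ->
  ('E_P[X \* Y] = 'E_P[X] * 'E_P[Y])%E.
Proof.
move=> /Lfun1_integrable iX /Lfun1_integrable iY /Lfun1_integrable iXY XY.
have mZ : measurable_fun setT (fun w => (X w, Y w)) by exact: measurable_fun_pair.
pose Z : {RV P >-> (R * R)%type} := mfun_Sub (mem_set mZ).
pose f : R * R -> \bar R := fun z => (z.1 * z.2)%:E.
have mf : measurable_fun setT f.
  by apply/measurable_EFinP; apply: measurable_funM.
pose mX := distribution P X; pose mY := distribution P Y; pose mZ' := distribution P Z.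
have prodE (A : set (R * R)) : measurable A -> (mX \x mY)%E A = mZ' A.
  by move=> mA; exact: product_measure_unique.
have ifZ : P.-integrable setT (f \o Z) by [].
have ifmZ : mZ'.-integrable setT f by exact: (integrable_pushforward mZ).
have ifXY : (mX \x mY)%E.-integrable setT f.
  apply/integrableP; split => //; case/integrableP : ifmZ => _; apply: le_lt_trans.
  rewrite le_eqVlt; apply/orP; left; apply/eqP.
  by apply: eq_measure_integral => A mA _; exact: prodE.
have -> : 'E_P[X \* Y]%E = (\int[mZ']_z f z)%E.
  by rewrite unlock (integral_distribution (X := Z)).
have -> : (\int[mZ']_z f z = \int[mX \x mY]_z f z)%E.
  by apply: eq_measure_integral => A mA _; exact/esym/prodE.
rewrite -integral12_prod_meas1// /fubini_F.
have EYfin : 'E_P[Y]%E \is a fin_num by apply: expectation_fin_num; exact/Lfun1_integrable.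
have mid : measurable_fun setT (EFin \o @idfun R).
  by apply/measurable_EFinP; exact: measurable_id.
have iidX : mX.-integrable setT (EFin \o @idfun R).
  by apply: (@integrable_pushforward _ _ _ _ R X) => //; exact: measurable_funPT.
have iidY : mY.-integrable setT (EFin \o @idfun R).
  by apply: (@integrable_pushforward _ _ _ _ R Y) => //; exact: measurable_funPT.
have EYE : (\int[mY]_y (EFin \o @idfun R) y = 'E_P[Y])%E.
  by rewrite unlock (integral_distribution mid).
have EXE : (\int[mX]_x (EFin \o @idfun R) x = 'E_P[X])%E.
  by rewrite unlock (integral_distribution mid).
transitivity (\int[mX]_x ((EFin \o @idfun R) x * 'E_P[Y]))%E.
  apply: eq_integral => x _; rewrite -EYE -integralZl//.
by rewrite -[X in (_ * X)%E](fineK EYfin) -EXE -integralZr// fineK.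
Qed.

End Independence.

(** * Independence of blocks of rounds, and Chebyshev's inequality for block means *)

Section Blocks.
Context {R : realType} {dO : measure_display} {Omega : measurableType dO}.
Variables (P : probability Omega R) (X : nat -> Omega -> R).
Hypothesis mX : forall t, measurable_fun setT (X t).

Definition rect (S : seq nat) (B : nat -> set R) : set Omega :=
  [set w | forall t, t \in S -> B t (X t w)].

(** A pi-system generating the sigma-algebra of the variables [X t] with [t] in [S]. *)
Definition rects (S : seq nat) : set (set Omega) :=
  [set A | exists2 B : nat -> set R, (forall t, measurable (B t)) & A = rect S B].

Hypothesis indep : forall (S : seq nat) (B : nat -> set R), uniq S ->
  (forall t, measurable (B t)) ->
  P (rect S B) = (\prod_(t <- S) P (X t @^-1` B t))%E.

Lemma measurable_rect S B : (forall t, measurable (B t)) -> measurable (rect S B).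
Proof.
move=> mB.
have -> : rect S B = \bigcap_(t in [set` S]) X t @^-1` B t.
  by apply/seteqP; split => w /= H t; apply: H.
apply: fin_bigcap_measurable => // t _.
by rewrite -[_ @^-1` _]setTI; exact: mX.
Qed.

Lemma setI_closed_rects S : setI_closed (rects S).
Proof.
move=> _ _ [B mB ->] [C mC ->]; exists (fun t => B t `&` C t).
  by move=> t; exact: measurableI.
apply/seteqP; split => w /=.
  by move=> [HB HC] t tS; split; [exact: HB|exact: HC].
by move=> H; split => t /H [].
Qed.

Lemma sub_rects_measurable S : rects S `<=` measurable.
Proof. by move=> _ [B mB ->]; exact: measurable_rect. Qed.

Lemma sigma_rects_measurable S : <<s rects S >> `<=` measurable.
Proof. exact: smallest_sub (@sigma_algebra_measurable _ Omega) (@sub_rects_measurable S). Qed.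

Lemma rects_setT S : rects S setT.
Proof. by exists (fun=> setT) => //; apply/seteqP; split. Qed.

(* Dynkin's pi-lambda theorem upgrades one block after the other from rectangles to the
   sigma-algebra of the block. *)
Lemma blocks_indep (L : seq nat) (b : nat -> seq nat) (A : nat -> set Omega)
    (S : seq nat) (B : nat -> set R) :
  uniq (S ++ flatten [seq b l | l <- L]) -> (forall t, measurable (B t)) ->
  (forall l, l \in L -> <<s rects (b l) >> (A l)) ->
  P (rect S B `&` \big[setI/setT]_(l <- L) A l) =
  (P (rect S B) * \prod_(l <- L) P (A l))%E.
Proof.
elim: L S B => [|l L IH] S B; first by rewrite !big_nil setIT mule1.
move=> /= uS mB AL.
set C := rect S B `&` \big[setI/setT]_(l <- L) A l.
have AL' l' : l' \in L -> <<s rects (b l') >> (A l').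
  by move=> l'L; apply: AL; rewrite inE l'L orbT.
have mC : measurable C.
  apply: measurableI; first exact: measurable_rect.
  rewrite big_seq; elim/big_ind : _ => //; first exact: measurableI.
  by move=> l' /AL'; exact: sigma_rects_measurable.
have [uSl uSL] : uniq ((b l ++ S) ++ flatten [seq b l | l <- L]) /\
    uniq (S ++ flatten [seq b l | l <- L]).
  split; first by rewrite -catA uniq_catCA.
  by move: uS; rewrite uniq_catCA cat_uniq => /and3P[].
have PC : P C = (P (rect S B) * \prod_(l <- L) P (A l))%E by exact: IH.
have PCfin : P C \is a fin_num by exact: fin_num_measure.
have PC0 : 0 <= fine (P C) by exact: fine_ge0.
(* Two finite measures of the event of block [l]: the probability of its intersection with [C], and
   [P C] times its probability. It suffices that they agree on the rectangles of the block. *)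
pose m1 : {measure set Omega -> \bar R} := mrestr P mC.
pose m2 : {measure set Omega -> \bar R} := mscale (NngNum PC0) P.
have main : m1 (A l) = m2 (A l).
  apply: (g_sigma_algebra_measure_unique (rects (b l)) _ (fun=> setT)) => //.
  - exact: sub_rects_measurable.
  - by move=> _; exact: rects_setT.
  - by rewrite bigcup_const.
  - exact: setI_closed_rects.
  - move=> _ [B1 mB1 ->]; rewrite /m1 /m2/= /mrestr /mscale/= fineK//.
    (* The two rectangles merge into one over [b l ++ S], to which the induction hypothesis applies;
       this is why the statement carries the extra factor [rect S B]. *)
    pose B' t := if t \in b l then B1 t else B t.
    have mB' t : measurable (B' t) by rewrite /B'; case: ifP.
    have dis t : t \in S -> t \notin b l.
      move=> tS; move: uSl; rewrite cat_uniq => /andP[]; rewrite cat_uniq => /and3P[_ /hasPn H _] _.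
      exact: H.
    have rectE : rect (b l) B1 `&` rect S B = rect (b l ++ S) B'.
      apply/seteqP; split => w /=.
        move=> [H1 H2] t; rewrite mem_cat /B'; case: ifPn => [tb _|tb /= tS]; first exact: H1.
        exact: H2.
      move=> H; split => t tS; have := H t; rewrite mem_cat tS ?orbT => /(_ isT); rewrite /B'.
        by rewrite tS.
      by rewrite (negbTE (dis _ tS)).
    rewrite PC /C setIA rectE IH// muleAC; congr (_ * _)%E.
    have ubS : uniq (b l ++ S) by move: uSl; rewrite cat_uniq => /andP[].
    have ub : uniq (b l) by move: ubS; rewrite cat_uniq => /andP[].
    have uS' : uniq S by move: uSL; rewrite cat_uniq => /andP[].
    rewrite !indep//.
    rewrite big_cat/= muleC; congr (_ * _)%E; rewrite big_seq [RHS]big_seq;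
      apply: eq_bigr => t tS; rewrite /B' ?tS//.
    by rewrite (negbTE (dis _ tS)).
  - by move=> _; rewrite /m1/= /mrestr setTI ltey_eq PCfin.
  - by apply: AL; rewrite mem_head.
have := main; rewrite /m1 /m2/= /mrestr /mscale/= fineK// => mainE.
by rewrite !big_cons setICA mainE PC muleAC -muleA.
Qed.

Definition blockmean (t0 n : nat) (w : Omega) : R :=
  n%:R^-1 * \sum_(r < n) X (t0 + r)%N w.

(** Strict, so that the event is still null for a coordinate of zero variance, where [eta] is 0. *)
Definition deviation (mu eta : R) (t0 n : nat) : set Omega :=
  [set w | eta < `|blockmean t0 n w - mu|].

(** Over the sigma-algebra generated by the rectangles of the block, each of its rounds is
    measurable, and the event is built from these alone. This is the form in which [blocks_indep]
    takes its events. *)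
Lemma deviation_sigma_rects (mu eta : R) t0 n :
  <<s rects (iota t0 n) >> (deviation mu eta t0 n).
Proof.
set S := iota t0 n; pose T' := g_sigma_algebraType (rects S).
have mXt (r : 'I_n) : measurable_fun setT (X (t0 + r)%N : T' -> R).
  move=> _ B mB; rewrite setTI; apply: sub_sigma_algebra.
  exists (fun t => if t == (t0 + r)%N then B else setT).
    by move=> t; case: ifP.
  apply/seteqP; split => w /=.
    by move=> BX t _; case: eqP => [->|].
  move=> /(_ (t0 + r)%N); rewrite eqxx; apply.
  by rewrite mem_iota leq_addr ltn_add2l ltn_ord.
have mean_meas : measurable_fun setT (blockmean t0 n : T' -> R).
  apply: measurable_funM => //; exact: measurable_sum.
have mdev : measurable_fun setT (fun w : T' => `|blockmean t0 n w - mu|).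
  by apply: measurableT_comp => //; exact: measurable_funB.
have := @measurable_fun_ltr _ T' R setT (cst eta) _ (measurable_cst _) mdev.
have mtrue : measurable [set true] by [].
by move=> /(_ measurableT _ mtrue); rewrite setTI.
Qed.

Lemma measurable_deviation mu eta t0 n : measurable (deviation mu eta t0 n).
Proof. exact: (@sigma_rects_measurable (iota t0 n) _ (@deviation_sigma_rects _ _ _ _)). Qed.

Variables (mu s2 M : R).
Hypothesis bX : forall t, {ae P, forall w, `|X t w| <= M}.
Hypothesis EX : forall t, 'E_P[X t]%E = mu%:E.
Hypothesis VX : forall t, covariance P (X t) (X t) = s2%:E.

Let X2 t : X t \in Lfun P 2%:E.
Proof. exact: Lfun2_ae_bounded (bX t). Qed.

Let Lfun21 (f : Omega -> R) : f \in Lfun P 2%:E -> f \in Lfun P 1.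
Proof. by apply: Lfun_subset12; exact: fin_num_measure. Qed.

Lemma covariance_indep0 s t : s != t -> covariance P (X s) (X t) = 0%E.
Proof.
move=> st.
rewrite (covarianceE (Lfun21 (X2 s)) (Lfun21 (X2 t)) (Lfun2_mul_Lfun1 (X2 s) (X2 t))).
pose Xs : {RV P >-> R} := mfun_Sub (mem_set (mX s)).
pose Xt : {RV P >-> R} := mfun_Sub (mem_set (mX t)).
have := @expectationM_indep _ _ _ P Xs Xt (Lfun21 (X2 s)) (Lfun21 (X2 t))
  (Lfun2_mul_Lfun1 (X2 s) (X2 t)).
have indepst (A B : set R) : measurable A -> measurable B ->
    P (Xs @^-1` A `&` Xt @^-1` B) = (P (Xs @^-1` A) * P (Xt @^-1` B))%E.
  move=> mA mB; pose C u := if u == s then A else if u == t then B else setT.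
  have mC u : measurable (C u) by rewrite /C; case: ifP => // _; case: ifP.
  have := @indep [:: s; t] C; rewrite /= inE st andbT => /(_ isT mC).
  rewrite big_cons big_seq1 /C eqxx [t == s]eq_sym (negbTE st) eqxx => <-.
  congr (P _); apply/seteqP; split => w /=.
    move=> [As Bt] u; rewrite !inE => /orP[/eqP->|/eqP->]; rewrite /C ?eqxx//.
    by rewrite eq_sym (negbTE st).
  move=> H; split; first by have := H s; rewrite /C !inE !eqxx /=; apply.
  by have := H t; rewrite /C !inE !eqxx orbT [t == s]eq_sym (negbTE st) /=; apply.
move=> /(_ indepst) E; rewrite [X in (X - _)%E]E.
by rewrite subee// fin_numM//; apply: expectation_fin_num; exact: (Lfun21 (X2 _)).
Qed.

Let S t0 n w := \sum_(r < n) X (t0 + r)%N w.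

Let S0 t0 : S t0 0 = cst 0.
Proof. by apply/funext => w; rewrite /S big_ord0. Qed.

Let SS t0 n : S t0 n.+1 = S t0 n \+ X (t0 + n)%N.
Proof. by apply/funext => w; rewrite /S big_ord_recr. Qed.

Let S2 t0 n : S t0 n \in Lfun P 2%:E.
Proof.
elim: n => [|n IH]; first by rewrite S0 Lfun_cst.
by rewrite SS rpredD ?lee1n.
Qed.

Let covS t0 n t : (t0 + n <= t)%N -> covariance P (S t0 n) (X t) = 0%E.
Proof.
elim: n => [_|n IH nt]; first by rewrite S0 covariance_cst_l.
rewrite SS covarianceDl// IH ?add0e; last by rewrite (leq_trans _ nt)// addnS.
by rewrite covariance_indep0// neq_ltn -addnS nt.
Qed.

Let varS t0 n : variance P (S t0 n) = (n%:R * s2)%:E.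
Proof.
elim: n => [|n IH]; first by rewrite S0 variance_cst mul0r.
rewrite SS varianceD// IH covS ?leqnn// mule0 adde0 /variance VX -EFinD.
by congr EFin; rewrite -natr1 mulrDl mul1r.
Qed.

Let expS t0 n : 'E_P[S t0 n]%E = (n%:R * mu)%:E.
Proof.
elim: n => [|n IH]; first by rewrite S0 expectation_cst mul0r.
rewrite SS expectationD ?Lfun21// IH EX -EFinD.
by congr EFin; rewrite -natr1 mulrDl mul1r.
Qed.

(** Chebyshev: distinct rounds are uncorrelated, so the block mean has variance s2 / n, and [s2]
    cancels against the threshold. *)
Lemma deviation_le t0 n (eps : R) : (0 < n)%N -> 0 < eps ->
  (P (deviation mu (eps * Num.sqrt s2) t0 n) <= ((n%:R * eps ^+ 2)^-1)%:E)%E.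
Proof.
move=> n0 eps0; have n0' : n%:R != 0 :> R by rewrite pnatr_eq0 -lt0n.
have bmE : blockmean t0 n = n%:R^-1 \o* S t0 n.
  by apply/funext => w; rewrite /blockmean /= mulrC.
have bm2 : blockmean t0 n \in Lfun P 2%:E by rewrite bmE Lfun_scale ?ler1n.
have mbm : measurable_fun setT (blockmean t0 n).
  by move: bm2; rewrite inE => /andP[/[!inE]].
pose Y : {RV P >-> R} := mfun_Sub (mem_set mbm).
have EY : fine ('E_P[Y])%E = mu.
  rewrite (_ : (Y : Omega -> R) = n%:R^-1 \o* S t0 n)// expectationZl ?Lfun21// expS.
  by rewrite -EFinM/= mulrA mulVf// mul1r.
have VY : variance P Y = (s2 / n%:R)%:E.
  rewrite (_ : (Y : Omega -> R) = n%:R^-1 \o* S t0 n)// varianceZ// varS -EFinM.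
  by congr EFin; field.
pose wdev (eta : R) : set Omega := [set w | eta <= `|blockmean t0 n w - mu|].
have cheb (eta : R) : 0 < eta -> (P (wdev eta) <= (eta ^- 2 * (s2 / n%:R))%:E)%E.
  by move=> eta0; have := @chebyshev _ _ _ P Y eta eta0; rewrite EY VY -EFinM.
have mwdev (eta : R) : measurable (wdev eta).
  have mY : measurable_fun setT (fun w => `|blockmean t0 n w - mu|).
    by apply: measurableT_comp => //; exact: measurable_funB.
  have := @measurable_fun_ler _ _ R setT (cst eta) _ (measurable_cst _) mY.
  have mtrue : measurable [set true] by [].
  by move=> /(_ measurableT _ mtrue); rewrite setTI.
have s20 : 0 <= s2 by rewrite -lee_fin -(VX 0) -/(variance P (X 0)) variance_ge0.
(* At zero variance the threshold is 0, out of reach of Chebyshev; the event is then the countable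
   union of the null events with thresholds 1 / (k + 1). *)
move: s20; rewrite le_eqVlt => /predU1P[s20|s20].
  rewrite -s20 sqrtr0 mulr0.
  have : P.-negligible (deviation mu 0 t0 n).
    have -> : deviation mu 0 t0 n =
        \bigcup_k wdev k.+1%:R^-1.
      apply/seteqP; split => w /=; rewrite /deviation/=.
        move=> w0; exists (Num.truncn `|blockmean t0 n w - mu|^-1) => //=.
        by rewrite /wdev/= invf_ple ?posrE ?ltr0n// ltW// truncnS_gt.
      by move=> [k _]; apply: lt_le_trans; rewrite invr_gt0 ltr0n.
    apply: negligible_bigcup => k; apply/negligibleP => //.
    apply/eqP; rewrite -measure_le0.
    have := cheb k.+1%:R^-1; rewrite -s20 mul0r mulr0 invr_gt0 ltr0n; exact.
  move/negligibleP => /(_ (measurable_deviation _ _ _ _)) ->.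
  by rewrite lee_fin invr_ge0 mulr_ge0 ?sqr_ge0.
have eta0 : 0 < eps * Num.sqrt s2 by rewrite mulr_gt0 ?sqrtr_gt0.
apply: (@le_trans _ _ (P (wdev (eps * Num.sqrt s2)))).
  by apply: le_measure; rewrite ?inE//=; [exact: measurable_deviation|move=> w /ltW].
apply: (le_trans (cheb _ eta0)); rewrite lee_fin exprMn sqr_sqrtr ?(ltW s20)//.
rewrite le_eqVlt; apply/orP; left; apply/eqP; field.
by rewrite n0' !gt_eqF.
Qed.

End Blocks.

(** * Median of means *)

(** If the median lies above [c], all entries from its position on are at least as far from [c]; if
    below, all entries up to it are. For the lower median both ranges contain at least half of the
    entries. *)
Lemma median_count {R : realType} (s : seq R) (c eta : R) : (0 < size s)%N ->
  eta < `|median s - c| ->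
  (((size s).-1./2).+1 <= count (fun x => (eta < `|x - c|)%R) s)%N.
Proof.
move=> s0; set k := (size s).-1./2; set a := fun x => eta < `|x - c|.
have k_lt : (k < size s)%N by rewrite /k; lia.
rewrite /median -/k => med.
have /permP <- : perm_eq (sort <=%R s) s by apply/permPl/perm_sort.
set s' := sort <=%R s in med *.
have szs : size s' = size s by rewrite size_sort.
have srt : sorted <=%R s' by apply: sort_sorted; exact: le_total.
have mono i j : (i <= j)%N -> (j < size s)%N -> nth 0 s' i <= nth 0 s' j.
  move=> ij js; apply: (sorted_leq_nth (@le_trans _ R) (@lexx _ R)) => //.
    by rewrite inE szs (leq_ltn_trans ij).
  by rewrite inE szs.
have [hi|lo] := leP c (nth 0 s' k).
  rewrite ger0_norm ?subr_ge0// in med.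
  have : all a (drop k s').
    apply/(all_nthP 0) => i; rewrite size_drop szs nth_drop => ik.
    rewrite /a (lt_le_trans med)// (le_trans _ (ler_norm _))// lerD2r mono//; lia.
  rewrite all_count size_drop szs => /eqP cnt.
  rewrite -(cat_take_drop k s') count_cat cnt (leq_trans _ (leq_addl _ _))// /k; lia.
rewrite ltr0_norm ?subr_lt0// opprB in med.
have : all a (take k.+1 s').
  apply/(all_nthP 0) => i; rewrite size_take szs => ik.
  have {ik}ik : (i < k.+1)%N by move: ik; case: ifP => //; lia.
  rewrite nth_take// /a (lt_le_trans med)// -normrN opprB (le_trans _ (ler_norm _))//.
  by rewrite lerD2l lerN2 mono//; lia.
rewrite all_count size_takel ?szs// => /eqP cnt.
by rewrite -(cat_take_drop k.+1 s') count_cat cnt leq_addr.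
Qed.

Lemma uniq_flatten_blocks (a stride n : nat) (L : seq nat) : (n <= stride)%N -> uniq L ->
  uniq (flatten [seq iota (a + l * stride) n | l <- L]).
Proof.
move=> ns; elim: L => //= l L IH /andP[lL uL].
rewrite cat_uniq iota_uniq IH// andbT /=; apply/hasPn => t /flattenP[_ /mapP[l' l'L ->]].
rewrite mem_iota => /andP[t1 t2]; apply/negP; rewrite mem_iota => /andP[t3 t4].
have ll' : l != l' by apply: contraNneq lL => ->.
case: (ltngtP l l') ll' => // ll' _; nia.
Qed.

Section MedianOfMeans.
Context {R : realType} {dO : measure_display} {Omega : measurableType dO}.
Variables (P : probability Omega R).

Lemma probability_bigsetU_le (I : Type) (r : seq I) (Q : pred I) (A : I -> set Omega)
    (u : I -> R) : (forall i, Q i -> measurable (A i)) ->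
  (forall i, Q i -> (P (A i) <= (u i)%:E)%E) ->
  (P (\big[setU/set0]_(i <- r | Q i) A i) <= (\sum_(i <- r | Q i) u i)%:E)%E.
Proof.
move=> mA Au; elim: r => [|i r IH]; first by rewrite !big_nil measure0.
rewrite !big_cons; case: ifPn => // Qi.
apply: (le_trans (measureU2 _ _ _)); first exact: mA.
  by apply: bigsetU_measurable => j /mA.
by rewrite EFinD leeD// Au.
Qed.

Variable (X : nat -> Omega -> R).
Hypothesis mX : forall t, measurable_fun setT (X t).
Hypothesis indep : forall (S : seq nat) (B : nat -> set R), uniq S ->
  (forall t, measurable (B t)) ->
  P (rect X S B) = (\prod_(t <- S) P (X t @^-1` B t))%E.

(** A cover of the event that the median misses, written as a union over the sets of half of the
    means (rounded up, for k > 0) so that the union bound and [blocks_indep] apply to it. *)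
Definition median_failure (mu eta : R) (a stride n k : nat) : set Omega :=
  \big[setU/set0]_(A : {set 'I_k} | #|A| == (k.-1./2).+1)
    \big[setI/setT]_(l <- [seq val l | l <- enum A]) deviation X mu eta (a + l * stride) n.

Lemma measurable_median_failure mu eta a stride n k :
  measurable (median_failure mu eta a stride n k).
Proof.
apply: bigsetU_measurable => A _; elim/big_ind : _ => //; first exact: measurableI.
by move=> l _; exact: measurable_deviation.
Qed.

Lemma median_failureP mu eta a stride n k w : (0 < k)%N ->
  ~ median_failure mu eta a stride n k w ->
  `|median [seq blockmean X (a + l * stride) n w | l <- iota 0 k] - mu| <= eta.
Proof.
move=> k0 nfail; rewrite leNgt; apply/negP => dev; apply: nfail.
set s := map _ _ in dev.
have szs : size s = k by rewrite size_map size_iota.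
have := @median_count R s mu eta; rewrite szs => /(_ k0 dev) cnt.
pose D : {set 'I_k} := finset (fun l : 'I_k => eta < `|blockmean X (a + l * stride) n w - mu|).
have cD : ((k.-1./2).+1 <= #|D|)%N.
  apply: (leq_trans cnt); rewrite /s count_map -val_enum_ord count_map.
  rewrite cardE /enum_mem size_filter -enumT.
  rewrite count_filter; apply: sub_count => l /= /andP[lD _].
  by have : l \in D; [rewrite finset.in_set|exact].
(* [median_count] provides at least half of the means; exactly that many are kept, to match the
   index sets of the union. *)
have [ls [uls szls lsD]] := card_geqP cD.
pose A : {set 'I_k} := finset (fun l => l \in ls).
have cA : #|A| = (k.-1./2).+1 by rewrite /A cardsE -szls; apply/card_uniqP.
rewrite /median_failure (bigD1 A)/=; last by rewrite cA.
left; rewrite big_seq; elim/big_ind : _ => //= _ /mapP[l + ->].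
by rewrite mem_enum inE => /lsD; rewrite inE.
Qed.

(** At most 2 ^ k index sets occur, and the blocks are disjoint because a block is no longer than
    the stride, so each intersection has the product probability. *)
Lemma median_failure_le mu eta a stride n k (u : R) : (n <= stride)%N -> 0 <= u ->
  (forall t0, (P (deviation X mu eta t0 n) <= u%:E)%E) ->
  (P (median_failure mu eta a stride n k) <= (2 ^+ k * u ^+ (k.-1./2).+1)%:E)%E.
Proof.
move=> ns u0 Pu.
apply: (@le_trans _ _ (\sum_(A : {set 'I_k} | #|A| == (k.-1./2).+1) u ^+ (k.-1./2).+1)%:E).
  apply: probability_bigsetU_le => A /eqP cA.
    elim/big_ind : _ => //; first exact: measurableI.
    by move=> l _; exact: measurable_deviation.
  set L := map _ _.
  have szL : size L = (k.-1./2).+1 by rewrite size_map -cardE.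
  have uL : uniq L by rewrite map_inj_uniq ?enum_uniq//; exact: val_inj.
  have := @blocks_indep _ _ _ P X mX indep L (fun l => iota (a + l * stride) n)
    (fun l => deviation X mu eta (a + l * stride) n) [::] (fun=> setT).
  rewrite cat0s uniq_flatten_blocks// => /(_ isT (fun=> measurableT)).
  rewrite (_ : rect X [::] _ = setT) ?probability_setT ?setTI ?mul1e; last first.
    by apply/seteqP; split.
  move=> -> => [|l _]; last exact: deviation_sigma_rects.
  rewrite -szL; elim: L {szL uL} => [|l L IH] /=; first by rewrite big_nil expr0.
  by rewrite big_cons exprS EFinM lee_pmul// prode_ge0.
rewrite lee_fin sumr_const -[leLHS]mulr_natl ler_wpM2r ?exprn_ge0// -natrX ler_nat.
have := card_powerset [set: 'I_k]%SET; rewrite cardsT card_ord => <-.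
by apply: subset_leq_card; apply/fintype.subsetP => A _; rewrite powersetE finset.subsetT.
Qed.

End MedianOfMeans.

(** * Ceilings, logarithms and telescoping sums *)

Section Numerics.
Context {R : realType}.
Implicit Types x v : R.

Lemma nat_ceil_itv x : 0 <= x ->
  x <= (nat_of_int (Num.ceil x))%:R /\ (nat_of_int (Num.ceil x))%:R < x + 1.
Proof.
move=> x0; have := ceil_itv x; have : 0 <= Num.ceil x by rewrite ceil_ge0 (lt_le_trans _ x0).
case: (Num.ceil x) => //= n _; rewrite rmorphB/= => /andP[h1 h2]; split => //.
by rewrite -ltrBlDr.
Qed.

Lemma nat_ceil_gt0 x : 0 < x -> (0 < nat_of_int (Num.ceil x))%N.
Proof.
move=> x0; have [h _] := nat_ceil_itv (ltW x0).
by rewrite -(ltr_nat R) (lt_le_trans x0).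
Qed.

Lemma ln2_ge_half : 2^-1 <= ln 2 :> R.
Proof.
have := @le_ln1Dx R (- 2^-1); rewrite ltrN2 invf_lt1 ?ltr1n// => /(_ isT).
have -> : 1 - 2^-1 = 2^-1 :> R by field.
by rewrite lnV ?posrE// lerN2.
Qed.

(** From ln (1 + z) <= z at z = - x / (1 + 2x), the difference of logarithms is at least x / (1 +
    2x); four times this exceeds 1 when x >= 1 and exceeds x when x <= 1. *)
Lemma min1_le_ln x : 0 < x -> Num.min 1 x <= 4 * (ln (1 + 2 * x) - ln (1 + x)).
Proof.
move=> x0; have x1 : 0 < 1 + x by rewrite addr_gt0.
have x2 : 0 < 1 + 2 * x by rewrite addr_gt0// mulr_gt0.
have h : x / (1 + 2 * x) <= ln (1 + 2 * x) - ln (1 + x).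
  have := @le_ln1Dx R (- (x / (1 + 2 * x))).
  rewrite ltrN2 ltr_pdivrMr// mul1r => /(_ _)/wrap[|].
    by move: x0 {x1 x2}; lra.
  have -> : 1 - x / (1 + 2 * x) = (1 + x) / (1 + 2 * x).
    by field; rewrite gt_eqF.
  by rewrite ln_div ?posrE// lerNr opprB.
apply: (le_trans _ (ler_wpM2l _ h)) => //.
rewrite mulrA ler_pdivlMr// /Num.min; case: ifP => x1'; first by move: x0 x1' {h x1 x2}; lra.
move/negbT: x1'; rewrite -leNgt => x1'; move: x0 x1' {h x1 x2}; nra.
Qed.

Lemma sum_min1_le v n : 0 < v ->
  \sum_(i < n) Num.min 1 (v * 2 ^+ i) <= 4 * ln (1 + v * 2 ^+ n).
Proof.
move=> v0; apply: (@le_trans _ _ (4 * (ln (1 + v * 2 ^+ n) - ln (1 + v)))).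
  elim: n => [|n IH]; first by rewrite big_ord0 expr0 mulr1 subrr mulr0.
  rewrite big_ord_recr/=.
  have vn : 0 < v * 2 ^+ n by rewrite mulr_gt0// exprn_gt0.
  have := lerD IH (min1_le_ln vn); rewrite (_ : 2 * (v * 2 ^+ n) = v * 2 ^+ n.+1).
    by move/le_trans; apply; rewrite -mulrDr addrC addrA subrK.
  by rewrite exprS; ring.
by rewrite ler_wpM2l// gerBl ln_ge0// lerDl ltW.
Qed.

(** The phase of a round and the phase whose estimate is exploited are both heads of a filtered
    [iota], hence first indices passing a test. *)
Lemma head_filter_iota (p : pred nat) a n h s : [seq j <- iota a n | p j] = h :: s ->
  [/\ p h, (a <= h)%N & forall i, (a <= i < h)%N -> ~~ p i].
Proof.
elim: n a => //= n IH a; case: ifPn => [pa [<- _]|npa /IH[ph ah H]].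
  by split => // i; lia.
split => //; first exact: ltnW.
move=> i /andP[ai ih]; move: ai; rewrite leq_eqVlt => /predU1P[<-//|ai].
by apply: H; rewrite ai.
Qed.

End Numerics.

(** * The phase schedule and the rounds spent in each phase *)

Section Schedule.
Context {R : realType} (d T : nat) (delta q s2 : R).
Local Notation K := (@kappa R d T delta).
Local Notation al := (@alpha R d T delta q s2).
Local Notation N := (@Nhat R).
Local Notation tj := (@Tj R d T delta q s2).
Local Notation len := (@phase_len R d T delta q s2).
Local Notation start := (@phase_start R d T delta q s2).
Local Notation phase := (@phase_of R d T delta q s2).
Local Notation eps := (@epshat R d T delta q s2).

Definition xphase (j : nat) : R := 8 / eps j ^+ 2.
Local Notation x := xphase.

Hypothesis d0 : (0 < d)%N.
Hypothesis T0 : (0 < T)%N.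
Hypothesis K0 : (0 < K)%N.
Hypothesis q0 : 0 < q.
Hypothesis s20 : 0 < s2.

Lemma Nhat_gt0 j : 0 < N j.
Proof. by rewrite /Nhat divr_gt0// exprn_gt0. Qed.

Lemma NhatS j : N j = 2 * N j.+1.
Proof. by rewrite /Nhat exprS; field; rewrite expf_neq0// pnatr_eq0. Qed.

Lemma alpha_gt0 : 0 < al.
Proof. by rewrite /alpha powR_gt0// divr_gt0 ?mulr_gt0 ?ltr0n. Qed.

Lemma alpha4 : al ^+ 4 = d%:R * K%:R / (T%:R * q * s2).
Proof.
rewrite /alpha -powR_mulrn ?powR_ge0// -powRrM mulVf ?pnatr_eq0// powRr1//.
by rewrite divr_ge0 ?mulr_ge0 ?ler0n// ltW.
Qed.

Lemma epshat_gt0 j : 0 < eps j.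
Proof. by rewrite /epshat mulr_gt0 ?alpha_gt0// sqrtr_gt0 Nhat_gt0. Qed.

Lemma epshat2 j : eps j ^+ 2 = al ^+ 2 * N j.
Proof. by rewrite /epshat exprMn sqr_sqrtr// ltW// Nhat_gt0. Qed.

Lemma xphase_gt0 j : 0 < x j.
Proof. by rewrite /xphase divr_gt0// exprn_gt0// epshat_gt0. Qed.

(** This product does not depend on [j], so [xphase] doubles while [Nhat] halves. *)
Lemma NhatM_xphase j : N j * x j = 8 / al ^+ 2.
Proof.
rewrite /xphase epshat2; field.
by rewrite !gt_eqF// ?Nhat_gt0 ?alpha_gt0.
Qed.

Lemma xphaseS j : x j.+1 = x 1 * 2 ^+ j.
Proof.
elim: j => [|j IH]; first by rewrite expr0 mulr1.
have NN := Nhat_gt0 j.+2.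
apply: (mulfI (lt0r_neq0 NN)); rewrite NhatM_xphase -(NhatM_xphase j.+1) IH.
by rewrite (NhatS j.+1) exprS; ring.
Qed.

Lemma Tj_ge j : x j <= (tj j)%:R.
Proof. by have [] := nat_ceil_itv (ltW (xphase_gt0 j)). Qed.

Lemma Tj_gt0 j : (0 < tj j)%N.
Proof. exact: nat_ceil_gt0 (xphase_gt0 j). Qed.

(** For x_j <= 1 the ceiling is 1; otherwise it exceeds x_j by at most 1. The minimum keeps the
    excess over 1 summable after multiplication by N_j, however many phases there are. *)
Lemma Tj_le j : (tj j)%:R <= 1 + x j * Num.min 1 (x j).
Proof.
have [_ lt] := nat_ceil_itv (ltW (xphase_gt0 j)).
have x0 := xphase_gt0 j.
rewrite /Num.min; case: ifPn => [x1|]; first by rewrite mulr1 addrC ltW.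
rewrite -leNgt => x1; have : (tj j)%:R < 2 :> R.
  by apply: (lt_le_trans lt); rewrite -/(x j) -[2]/(1 + 1) lerD2r.
rewrite ltr_nat ltnS => t1; apply: (@le_trans _ _ 1).
  by rewrite lern1.
by rewrite lerDl mulr_ge0 // ltW.
Qed.

Lemma phase_startS j : (0 < j)%N -> start j.+1 = (start j + len j)%N.
Proof. by move=> j0; rewrite /phase_start big_nat_recr. Qed.

Lemma phase_start1 : start 1 = 0%N.
Proof. by rewrite /phase_start big_geq. Qed.

Lemma phase_len_gt0 j : (0 < len j)%N.
Proof. by rewrite /phase_len !muln_gt0 K0 d0 Tj_gt0. Qed.

Lemma leq_phase_startS j : (j <= start j.+1)%N.
Proof.
elim: j => // j IH; rewrite phase_startS//.
by have := phase_len_gt0 j.+1; lia.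
Qed.

Lemma phase_start_mono i j : (0 < i)%N -> (i <= j)%N -> (start i <= start j)%N.
Proof.
move=> i0; elim: j => [|j IH]; first by rewrite leqn0 => /eqP ->.
rewrite leq_eqVlt => /predU1P[->//|ij].
have {}ij : (i <= j)%N by rewrite -ltnS.
by rewrite phase_startS ?(leq_trans i0)// (leq_trans (IH ij))// leq_addr.
Qed.

(** The search up to t + 1 succeeds because every phase lasts at least one round; minimality of the
    index found gives the lower bound on [t]. *)
Lemma phase_ofP t : [/\ (0 < phase t)%N, (start (phase t) <= t)%N & (t < start (phase t).+1)%N].
Proof.
rewrite /phase_of.
case E : [seq j <- iota 1 t.+1 | (t < start j.+1)%N] => [|h s] /=.
  have : t.+1 \in [seq j <- iota 1 t.+1 | (t < start j.+1)%N].
    by rewrite mem_filter leq_phase_startS mem_iota/=; lia.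
  by rewrite E.
have [th h0 H] := head_filter_iota E; split => //.
case: h h0 th H {E} => // -[|h] _ th H; first by rewrite phase_start1.
by have := H h.+1; rewrite ltnSn/= -leqNgt; apply.
Qed.

Lemma phase_of_uniq t j : (0 < j)%N -> (start j <= t)%N -> (t < start j.+1)%N -> phase t = j.
Proof.
move=> j0 sj tj; have [p0 sp tp] := phase_ofP t.
case: (ltngtP (phase t) j) => // h.
  by have := @phase_start_mono (phase t).+1 j isT h; lia.
by have := @phase_start_mono j.+1 (phase t) isT h; lia.
Qed.

Lemma sum_phase_of (f : nat -> R) J : \sum_(0 <= t < start J.+1) f (phase t) =
  \sum_(1 <= j < J.+1) (len j)%:R * f j.
Proof.
elim: J => [|J IH]; first by rewrite phase_start1 !big_geq.
rewrite big_nat_recr//= -IH phase_startS// (big_cat_nat (n := start J.+1))/= ?leq_addr//.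
congr (_ + _); rewrite (eq_big_nat _ _ (F2 := fun=> f J.+1)).
  by rewrite sumr_const_nat addKn mulr_natl.
by move=> t /andP[t1 t2]; rewrite (@phase_of_uniq t J.+1)// phase_startS.
Qed.

Lemma sum_Nhat_le2 J : \sum_(1 <= j < J.+1) N j <= 2.
Proof.
suff -> : \sum_(1 <= j < J.+1) N j = 2 - 2 * N J.+1.
  by rewrite gerBl mulr_ge0// ltW// Nhat_gt0.
elim: J => [|J IH]; first by rewrite big_geq// /Nhat expr1 divff ?pnatr_eq0// mulr1 subrr.
by rewrite big_nat_recr//= IH (NhatS J.+1); ring.
Qed.

Lemma sum_min1_xphase_le J : \sum_(1 <= j < J.+1) Num.min 1 (x j) <= 4 * ln (1 + 2 * x J).
Proof.
case: J => [|J].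
  by rewrite big_geq// mulr_ge0// ln_ge0// lerDl mulr_ge0// ltW// xphase_gt0.
rewrite big_add1/= big_mkord.
under eq_bigr do rewrite xphaseS.
have := sum_min1_le J.+1 (xphase_gt0 1).
by rewrite (xphaseS J) exprS mulrCA.
Qed.

Definition lastphase := phase T.-1.

Lemma lastphaseP : [/\ (0 < lastphase)%N, (start lastphase < T)%N & (T <= start lastphase.+1)%N].
Proof. by have [h1 h2 h3] := phase_ofP T.-1; split => //; rewrite /lastphase; lia. Qed.

(** The phase before the last one is completed within the horizon, so its repetitions, at least x_j
    many, number at most [T]. *)
Lemma xphase_last_le J : lastphase = J.+2 -> x J.+1 <= T%:R.
Proof.
move=> E; have [_ + _] := lastphaseP; rewrite E phase_startS// => lt.
apply: (le_trans (Tj_ge _)); rewrite ler_nat.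
have : (tj J.+1 <= len J.+1)%N by rewrite /phase_len leq_pmull// muln_gt0 K0 d0.
by lia.
Qed.

Lemma sum_min1_before_last :
  \sum_(1 <= j < lastphase) Num.min 1 (x j) <= 4 * ln (1 + 2 * T%:R).
Proof.
have [l0 _ _] := lastphaseP.
have lnT : 0 <= ln (1 + 2 * T%:R) :> R by rewrite ln_ge0// lerDl mulr_ge0.
case E : lastphase => [|[|J]].
- by rewrite big_geq// mulr_ge0.
- by rewrite big_geq// mulr_ge0.
apply: (le_trans (sum_min1_xphase_le J.+1)).
have x0 := xphase_gt0 J.+1.
rewrite ler_wpM2l// ler_ln ?posrE.
- by rewrite lerD2l ler_wpM2l// xphase_last_le.
- by rewrite addr_gt0// mulr_gt0.
- by rewrite addr_gt0// mulr_gt0// ltr0n.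
Qed.

(** The sum is extended to the end of the last phase and regrouped by phases. By [Tj_le] a phase
    contributes N_j, a geometric series, plus a constant times min(1, x_j). The final + 1 is the
    minimum of the last phase, whose x_j may exceed [T]. *)
Lemma sum_Nhat_phase_le : \sum_(t < T) N (phase t) <=
  K%:R * d%:R * (2 + 8 / al ^+ 2 * (4 * ln (1 + 2 * T%:R) + 1)).
Proof.
have [l0 _ Tle] := lastphaseP.
rewrite -(big_mkord xpredT (fun t => N (phase t))).
apply: (@le_trans _ _ (\sum_(0 <= t < start lastphase.+1) N (phase t))).
  rewrite [leRHS](big_cat_nat (n := T))//= lerDl.
  by apply: sumr_ge0 => t _; rewrite ltW// Nhat_gt0.
rewrite sum_phase_of.
apply: (@le_trans _ _ (K%:R * d%:R * (\sum_(1 <= j < lastphase.+1) N j +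
    8 / al ^+ 2 * \sum_(1 <= j < lastphase.+1) Num.min 1 (x j)))).
  rewrite mulr_sumr -big_split/= mulr_sumr; apply: ler_sum => j _.
  rewrite /phase_len !natrM -mulrA ler_wpM2l ?mulr_ge0//.
  rewrite -(NhatM_xphase j) [leLHS]mulrC.
  have -> (y z u : R) : y + y * z * u = y * (1 + z * u) by clear; ring.
  by rewrite ler_wpM2l ?Tj_le// ltW// Nhat_gt0.
rewrite ler_wpM2l ?mulr_ge0// lerD ?sum_Nhat_le2// ler_wpM2l//.
  by rewrite divr_ge0 ?sqr_ge0.
rewrite big_nat_recr//= lerD ?sum_min1_before_last//.
by rewrite ge_min lexx.
Qed.

End Schedule.

(** * Deterministic regret bound when the estimates are accurate *)

Section RegretArithmetic.
Context {R : realType}.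
Implicit Types a b n q : R.

Lemma mulr_le_addsqr a b : 0 <= a -> 0 <= b -> a * b <= a ^+ 2 + b ^+ 2.
Proof. by move=> a0 b0; nra. Qed.

Lemma explore_arith n a q : 2 <= q -> 0 <= n -> 0 <= a ->
  2 * (4 * n + a) <= 8 * n + 9 * q * a.
Proof. by move=> q2 n0 a0; nra. Qed.

Lemma exploit_arith n a q : 2 <= q -> 0 <= n -> 0 <= a ->
  8 * (q - 1) * a <= 8 * n + 9 * q * a.
Proof. by move=> q2 n0 a0; nra. Qed.

Lemma total_arith a b (S L : R) : S <= a * 2 + b * (8 * (4 * L + 1)) ->
  8 * S + 9 * b <= 16 * a + b * (256 * L + 73).
Proof. by move=> h; lra. Qed.

End RegretArithmetic.

Section Regret.
Context {R : realType} (d T : nat) (delta p q s2 : R) (theta : nat -> 'I_d -> R).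
Variables (astar thetastar : 'I_d -> R).
Local Notation K := (@kappa R d T delta).
Local Notation al := (@alpha R d T delta q s2).
Local Notation N := (@Nhat R).
Local Notation start := (@phase_start R d T delta q s2).
Local Notation phase := (@phase_of R d T delta q s2).
Local Notation that := (@thetahat R d T delta q s2 theta).
Local Notation action := (@valee_action R d T delta q s2 theta).

Hypothesis d0 : (0 < d)%N.
Hypothesis q2 : 2 <= q.
Hypothesis pq : p^-1 + q^-1 = 1.
Hypothesis astar1 : lpnorm p astar <= 1.
Hypothesis thetastar1 : lpnorm q thetastar <= 1.

Let q1 : 1 < q.
Proof. by rewrite (lt_le_trans _ q2)// ltr1n. Qed.

Let q0 : 0 < q.
Proof. by rewrite (lt_trans _ q1). Qed.

Let p0 : 0 < p.
Proof. by rewrite -invr_gt0 (_ : p^-1 = 1 - q^-1) ?subr_gt0 ?invf_lt1// -pq addrK. Qed.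

Lemma lpnorm_valee_action t : lpnorm p (action t) <= 1.
Proof.
rewrite /valee_action.
case E : [seq j <- iota 1 t | _] => [|j s].
  by rewrite lpnorm_basis ?gt_eqF// ltn_mod.
have [/andP[+ _] _ _] := head_filter_iota E; rewrite /stops => st.
have th0 : lpnorm q (that j) != 0.
  by apply: lt0r_neq0; apply: lt_trans st; exact: Nhat_gt0.
by rewrite (lpnorm_exploit_action q1 pq th0).
Qed.

Lemma dotv_le_lpnorm (a v : 'I_d -> R) : lpnorm p a <= 1 -> dotv a v <= lpnorm q v.
Proof.
move=> a1; apply: (le_trans (hoelder_dotv a v p0 q0 pq)).
by rewrite ler_piMl ?lpnorm_ge0.
Qed.

Lemma gap_le_lpnorm t : dotv astar thetastar - dotv (action t) thetastar <=
  2 * lpnorm q thetastar.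
Proof.
have h1 := dotv_le_lpnorm thetastar astar1.
have h2 : dotv (fun i => - action t i) thetastar <= lpnorm q thetastar.
  by apply: dotv_le_lpnorm; rewrite lpnormN lpnorm_valee_action.
by rewrite mulr_natl mulr2n lerD// -dotvN.
Qed.

(** The crude bound that settles short horizons. *)
Lemma valee_regret_le2T :
  @valee_regret R d T delta q s2 theta astar thetastar <= 2 * T%:R.
Proof.
rewrite /valee_regret; apply: (@le_trans _ _ (\sum_(t < T) 2)).
  apply: ler_sum => t _; apply: (le_trans (gap_le_lpnorm t)).
  by rewrite ler_piMr.
by rewrite sumr_const card_ord mulr_natr.
Qed.

Hypothesis T0 : (0 < T)%N.
Hypothesis K0 : (0 < K)%N.
Hypothesis s20 : 0 < s2.

Let c := al * Num.sqrt s2.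

Hypothesis good : forall j, (0 < j)%N -> (start j.+1 < T)%N ->
  lpnorm q (fun i => thetastar i - that j i) <= c * Num.sqrt (N j).

Let c0 : 0 <= c.
Proof. by rewrite mulr_ge0 ?sqrtr_ge0// powR_ge0. Qed.

(** The stopping rule puts N_j below the norm of the estimate, the denominator in [dual_gap_le], and
    this cancels the N_j of the squared error c ^ 2 N_j. *)
Lemma exploit_gap_le j : (0 < j)%N -> (start j.+1 < T)%N ->
  stops T delta q s2 theta j ->
  dotv astar thetastar - dotv (exploit_action q (that j)) thetastar <= 8 * (q - 1) * c ^+ 2.
Proof.
move=> j0 jT; rewrite /stops => st; have N0 := @Nhat_gt0 R j.
have th0 : lpnorm q (that j) != 0 by apply: lt0r_neq0; exact: lt_trans st.
have gap := dual_gap_le thetastar q2 pq th0.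
have h := good j0 jT.
have h1 := dotv_le_lpnorm thetastar astar1.
have h0 := lpnorm_ge0 q (fun i => thetastar i - that j i).
move: gap h h1 h0 st.
move: (dotv astar _) (dotv _ _) (lpnorm q thetastar) (lpnorm q (that j))
  (lpnorm q (fun i => thetastar i - that j i)) => D D' L U h gap hc DL h0 NU.
have U0 := lt_trans N0 NU.
apply: (@le_trans _ _ (L - D')); first by rewrite lerD2r.
apply: (le_trans gap); rewrite -mulrA ler_wpM2l//.
  by rewrite mulr_ge0// subr_ge0 ltW.
rewrite ler_pdivrMr//; apply: (@le_trans _ _ (c ^+ 2 * N j)).
  by rewrite -[N j]sqr_sqrtr ?(ltW N0)// -exprMn ler_sqr ?nnegrE// mulr_ge0 ?sqrtr_ge0.
by rewrite ler_wpM2l ?sqr_ge0// ltW.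
Qed.

(** The previous phase did not stop, so its estimate has norm at most its N, which is twice the
    current one; the error c sqrt N of that estimate is at most N + c ^ 2. *)
Lemma explore_lpnorm_le t : (t < T)%N ->
  [seq j <- iota 1 t | stops T delta q s2 theta j && (start j.+1 <= t)%N] = [::] ->
  lpnorm q thetastar <= 4 * N (phase t) + c ^+ 2.
Proof.
move=> tT E; have [ph0 sp tp] := phase_ofP d0 T0 K0 q0 s20 t.
(* The first phase has no predecessor; there N is 1 and [thetastar1] suffices. *)
case: (phase t) ph0 sp tp => // -[_ _ _|j _ sp tp].
  apply: (le_trans thetastar1); rewrite /Nhat expr1 divff ?pnatr_eq0// mulr1.
  by rewrite (@le_trans _ _ 4)// ?ler1n// lerDl sqr_ge0.
have jt : (j.+1 <= t)%N.
  exact: leq_trans (leq_phase_startS d0 T0 K0 q0 s20 j.+1) sp.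
have : ~~ (stops T delta q s2 theta j.+1 && (start j.+2 <= t)%N).
  apply/negP => h.
  have : j.+1 \in [seq j <- iota 1 t | stops T delta q s2 theta j && (start j.+1 <= t)%N].
    by rewrite mem_filter h mem_iota; lia.
  by rewrite E.
rewrite sp andbT /stops -leNgt => thN.
have h := good (ltn0Sn j) (leq_ltn_trans sp tT).
have tri := lpnormD (that j.+1) (fun i => thetastar i - that j.+1 i) q1 pq.
have thE : thetastar = (fun i => that j.+1 i + (thetastar i - that j.+1 i)).
  by apply/funext => i; rewrite addrC subrK.
rewrite -thE in tri; have N0 := @Nhat_gt0 R j.+1.
have cN : c * Num.sqrt (N j.+1) <= N j.+1 + c ^+ 2.
  by have := mulr_le_addsqr c0 (sqrtr_ge0 (N j.+1)); rewrite sqr_sqrtr ?(ltW N0)// addrC.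
have -> : 4 * N j.+2 = 2 * N j.+1 by rewrite (NhatS j.+1); ring.
apply: (le_trans tri); apply: (le_trans (lerD thN (le_trans h cN))).
by rewrite addrA mulr_natl mulr2n.
Qed.

Lemma round_gap_le t : (t < T)%N ->
  dotv astar thetastar - dotv (action t) thetastar <= 8 * N (phase t) + 9 * q * c ^+ 2.
Proof.
move=> tT; have N0 := ltW (@Nhat_gt0 R (phase t)); have c20 := sqr_ge0 c.
case E : [seq j <- iota 1 t | stops T delta q s2 theta j && (start j.+1 <= t)%N] => [|j s].
  apply: (le_trans (gap_le_lpnorm t)).
  apply: (le_trans (ler_wpM2l (ler0n _ 2) (explore_lpnorm_le tT E))).
  exact: explore_arith.
have [/andP[st jt] j0 _] := head_filter_iota E.
rewrite /valee_action E.
apply: (le_trans (exploit_gap_le j0 (leq_ltn_trans jt tT) st)).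
exact: exploit_arith.
Qed.

Let Q := Num.sqrt (d%:R * K%:R * T%:R * q * s2).

Let dR : 0 < d%:R :> R. Proof. by rewrite ltr0n. Qed.
Let TR : 0 < T%:R :> R. Proof. by rewrite ltr0n. Qed.
Let KR : 0 < K%:R :> R. Proof. by rewrite ltr0n. Qed.

(** With [explore_scaleE], the reason for the choice of [alpha]: the costs of exploitation and of
    exploration are balanced at the common value [Q]. *)
Lemma exploit_scaleE : T%:R * q * s2 * al ^+ 2 = Q.
Proof.
have a0 := alpha_gt0 d0 T0 K0 q0 s20.
rewrite /Q -[LHS]ger0_norm -?sqrtr_sqr; last by rewrite !mulr_ge0 ?sqr_ge0 ?ltW.
congr Num.sqrt; rewrite exprMn -exprM alpha4//.
move: dR TR KR; move: (d%:R) (T%:R) (K%:R) => d' T' K' d'0 T'0 K'0; field.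
by rewrite !gt_eqF.
Qed.

Lemma explore_scaleE : K%:R * d%:R / al ^+ 2 = Q.
Proof.
have a0 := alpha_gt0 d0 T0 K0 q0 s20.
have a20 : al ^+ 2 != 0 by rewrite gt_eqF// exprn_gt0.
rewrite -exploit_scaleE; apply: (mulIf a20); rewrite divfK// -[RHS]mulrA -exprD alpha4//.
move: dR TR KR; move: (d%:R) (T%:R) (K%:R) => d' T' K' d'0 T'0 K'0; field.
by rewrite !gt_eqF.
Qed.

(** Sums [round_gap_le] over the rounds: exploration gives 16 K d + Q (256 ln (1 + 2T) + 64) and
    exploitation gives 9 Q. *)
Lemma valee_regret_good_le :
  @valee_regret R d T delta q s2 theta astar thetastar <=
  16 * (K%:R * d%:R) + Q * (256 * ln (1 + 2 * T%:R) + 73).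
Proof.
rewrite /valee_regret.
apply: (@le_trans _ _ (\sum_(t < T) (8 * N (phase t) + 9 * q * c ^+ 2))).
  by apply: ler_sum => t _; exact: round_gap_le.
rewrite big_split/= -mulr_sumr sumr_const card_ord.
have cQ : 9 * q * c ^+ 2 *+ T = 9 * Q.
  rewrite -exploit_scaleE /c exprMn sqr_sqrtr ?ltW// -mulr_natl.
  by move: (T%:R) (al ^+ 2) => ? ?; ring.
have := sum_Nhat_phase_le d0 T0 K0 q0 s20.
rewrite cQ; move: explore_scaleE; move: (\sum_(t < T) _) (ln _) => S L.
rewrite mulrDr (_ : K%:R * d%:R * (8 / al ^+ 2 * (4 * L + 1)) =
  K%:R * d%:R / al ^+ 2 * (8 * (4 * L + 1))); last by ring.
by move=> ->; exact: total_arith.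
Qed.

End Regret.

(** * Expectations of linear rewards, and sigma_q as a norm *)

Section ExpectationBounds.
Context {R : realType} {dO : measure_display} {Omega : measurableType dO}.
Variable P : probability Omega R.

Lemma expectation_lincomb (I : Type) (r : seq I) (a m : I -> R) (X : I -> Omega -> R) :
  (forall i, X i \in Lfun P 1) -> (forall i, 'E_P[X i]%E = (m i)%:E) ->
  (fun w => \sum_(i <- r) a i * X i w) \in Lfun P 1 /\
  'E_P[(fun w => \sum_(i <- r) a i * X i w)%R]%E = (\sum_(i <- r) a i * m i)%:E.
Proof.
move=> X1 EX; elim: r => [|i r [IH1 IH2]].
  rewrite big_nil (_ : (fun w => _) = cst 0); last by apply/funext => w; rewrite big_nil.
  by rewrite Lfun_cst expectation_cst.
rewrite big_cons (_ : (fun w => _) = (a i \o* X i) \+ (fun w => \sum_(i <- r) a i * X i w));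
  last by apply/funext => w; rewrite big_cons /= mulrC.
have aX1 : a i \o* X i \in Lfun P 1 by rewrite Lfun_scale.
split; first by rewrite rpredD.
by rewrite expectationD// IH2 expectationZl// EX.
Qed.

Lemma expectation_ae_le1 (Y : Omega -> R) (m : R) : measurable_fun setT Y ->
  {ae P, forall w, `|Y w| <= 1} -> 'E_P[Y]%E = m%:E -> m <= 1.
Proof.
move=> mY Y1 EY; rewrite -lee_fin -EY unlock.
have mY' : measurable_fun setT (EFin \o Y) by exact/measurable_EFinP.
apply: (le_trans (lee_abs _)); apply: (le_trans (le_abse_integral _ _ _)) => //.
apply: (@le_trans _ _ (\int[P]_x (cst 1%:E) x)%E); last first.
  by rewrite integral_cst//= probability_setT mule1.
apply: ae_ge0_le_integral => //; first exact: measurableT_comp.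
by apply: filterS Y1 => w; rewrite lee_fin.
Qed.

End ExpectationBounds.

Lemma sqrt_powR {R : realType} (x q : R) : 0 <= x -> Num.sqrt x `^ q = x `^ (q / 2).
Proof. by move=> x0; rewrite -powR12_sqrt// -powRrM mulrC. Qed.

(** How sigma_q enters: it is the l_q norm of the vector of standard deviations, to which the
    coordinatewise errors are proportional. *)
Lemma lpnorm_sqrt_diag {R : realType} (d : nat) (q : R) (Sigma : 'M[R]_d) :
  0 < q -> (forall i, 0 <= Sigma i i) ->
  lpnorm q (fun i => Num.sqrt (Sigma i i)) = Num.sqrt (sigma_q2 q Sigma).
Proof.
move=> q0 S0; rewrite /sigma_q2 /lpnorm.
rewrite -powR12_sqrt ?powR_ge0// -powRrM.
rewrite (_ : 2 / q * 2^-1 = q^-1); last by field; rewrite gt_eqF.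
by congr powR; apply: eq_bigr => i _; rewrite ger0_norm ?sqrtr_ge0// sqrt_powR.
Qed.

(** * Tail probabilities, from Chebyshev's rate to the choice of [kappa] *)

Section Tail.
Context {R : realType}.
Implicit Types x y u : R.

(** The left side is Chebyshev's rate for eps ^ 2 = 8 / x; it equals x / (8 n), where n is at least
    both 1 and x. *)
Lemma deviation_rate_le x (n : nat) : 0 < x -> (0 < n)%N -> x <= n%:R ->
  (n%:R * (8 / x))^-1 <= Num.min 1 x / 8.
Proof.
move=> x0 n0 xn; have n1 : 1 <= n%:R :> R by rewrite ler1n.
have nR : 0 < n%:R :> R by rewrite ltr0n.
rewrite (_ : (n%:R * (8 / x))^-1 = x / n%:R / 8); last first.
  by move: nR x0; move: (n%:R) => t t0 x0; field; rewrite !gt_eqF.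
rewrite ler_pM2r ?invr_gt0// le_min ler_pdivrMr// mul1r xn/=.
by rewrite ler_pdivrMr// ler_peMr// ltW.
Qed.

(** With m the half of k, 2 ^ k <= 4 ^ m, and 4 ^ m (z / 8) ^ m = (z / 2) ^ m. One factor z is kept
    for the sum over phases, the others are at most 1; the constant 8 in [Tj] leaves the 2 ^ - m. *)
Lemma median_rate_le (k : nat) u x : 0 <= u -> u <= Num.min 1 x / 8 -> 0 < x ->
  2 ^+ k * u ^+ (k.-1./2).+1 <= Num.min 1 x * (2 ^+ (k.-1./2).+1)^-1.
Proof.
move=> u0 ux x0; set m := (k.-1./2).+1; set z := Num.min 1 x.
have z0 : 0 < z by rewrite lt_min ltr01.
have z1 : z <= 1 by rewrite ge_min lexx.
apply: (@le_trans _ _ (2 ^+ (2 * m) * (z / 8) ^+ m)).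
  apply: ler_pM; rewrite ?exprn_ge0//.
    by rewrite ler_weXn2l ?ler1n// /m; lia.
  by rewrite lerXn2r// nnegrE// (le_trans u0).
rewrite exprM -exprMn (_ : 2 ^+ 2 * (z / 8) = z / 2); last by field.
rewrite exprMn exprVn ler_wpM2r ?invr_ge0 ?exprn_ge0//.
by rewrite /m exprS ler_piMr ?(ltW z0)// exprn_ile1// ltW.
Qed.

(** Since ln 2 >= 1/2 and the exponent is at least k / 2, the logarithm of the right side is at
    least k / 4, hence at least 2 ln y: the role of the 8 in [kappa]. *)
Lemma pow2_ge_sqr y (k : nat) : 0 < y -> 8 * ln y <= k%:R ->
  y ^+ 2 <= 2 ^+ (k.-1./2).+1.
Proof.
move=> y0 yk; set m := (k.-1./2).+1.
rewrite -ler_ln ?posrE ?exprn_gt0// !lnXn//.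
rewrite -[ln y *+ 2]mulr_natl -[ln 2 *+ m]mulr_natl.
have mk : k%:R <= 2 * m%:R :> R by rewrite -natrM ler_nat /m; lia.
have l2 := @ln2_ge_half R; have m0 : 0 <= m%:R :> R by [].
have h : m%:R * 2^-1 <= m%:R * ln 2 :> R by rewrite ler_wpM2l.
move: yk mk h; move: (ln y) (ln (2 : R)) (m%:R : R) (k%:R : R); clear => ? ? ? ?; lra.
Qed.

Lemma kappa_arith (ld llT lL : R) (k Lam : R) : k < 8 * (ld + llT + lL) + 1 ->
  0 <= ld + llT + lL -> ld + llT + lL <= Lam - 1 -> k <= 8 * Lam.
Proof. by move=> *; lra. Qed.

End Tail.

(** * The probability that some estimate misses *)

Section GoodEvent.
Context {R : realType} {dO : measure_display} {Omega : measurableType dO}.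
Context (P : probability Omega R) (d T : nat) (q delta : R).
Variables (theta : nat -> 'I_d -> Omega -> R) (thetastar : 'I_d -> R) (Sigma : 'M[R]_d).
Local Notation s2 := (sigma_q2 q Sigma).
Local Notation K := (@kappa R d T delta).
Local Notation N := (@Nhat R).
Local Notation tj := (@Tj R d T delta q s2).
Local Notation start := (@phase_start R d T delta q s2).
Local Notation eps := (@epshat R d T delta q s2).
Local Notation x := (@xphase R d T delta q s2).
Local Notation J := (@lastphase R d T delta q s2).

Hypothesis mtheta : forall t i, measurable_fun setT (theta t i).
Hypothesis iid : iid_vectors P theta.
Hypothesis Etheta : forall t i, 'E_P[theta t i]%E = (thetastar i)%:E.
Hypothesis Vtheta : forall t i, covariance P (theta t i) (theta t i) = (Sigma i i)%:E.
Hypothesis btheta : forall t i, {ae P, forall w, `|theta t i w| <= 1}.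
Hypothesis d0 : (0 < d)%N.
Hypothesis T0 : (0 < T)%N.
Hypothesis K0 : (0 < K)%N.
Hypothesis q0 : 0 < q.
Hypothesis s20 : 0 < s2.

Let X (i : 'I_d) t := theta t i.

(** Rectangles that leave the other coordinates free reduce the independence of the vectors to that
    of one coordinate across rounds. *)
Lemma coordinate_indep i (S : seq nat) (B : nat -> set R) : uniq S ->
  (forall t, measurable (B t)) ->
  P (rect (X i) S B) = (\prod_(t <- S) P (X i t @^-1` B t))%E.
Proof.
move=> uS mB; pose B' t (k : 'I_d) := if k == i then B t else setT.
have mB' t k : measurable (B' t k) by rewrite /B'; case: ifP.
have rectE t : rect_event (theta t) (B' t) = X i t @^-1` B t.
  apply/seteqP; split => w /=; rewrite /rect_event /B' /=.
    by move=> /(_ i); rewrite eqxx.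
  by move=> h k; case: eqP => [->|].
have [_ /(_ S B' uS mB')] := iid.
under eq_bigr do rewrite rectE.
move=> <-; congr (P _); apply/seteqP; split => w h t tS.
  by have := h t tS; rewrite rectE.
by have := h t tS; rewrite rectE.
Qed.

Lemma Sigma_diag_ge0 i : 0 <= Sigma i i.
Proof. by rewrite -lee_fin -(Vtheta 0 i) -/(variance P (theta 0 i)) variance_ge0. Qed.

(** Each repetition plays all [d] basis vectors in turn for [Tj] rounds, whence the offset
    [i * tj j] and the stride [d * tj j]. *)
Definition coordinate_failure (j : nat) (i : 'I_d) : set Omega :=
  median_failure (X i) (thetastar i) (eps j * Num.sqrt (Sigma i i))
    (start j + i * tj j) (d * tj j) (tj j) K.

Lemma measurable_coordinate_failure j i : measurable (coordinate_failure j i).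
Proof. by apply: measurable_median_failure => t; exact: mtheta. Qed.

Lemma coordinate_failure_le j i :
  (P (coordinate_failure j i) <= (Num.min 1 (x j) * (2 ^+ (K.-1./2).+1)^-1)%:E)%E.
Proof.
have t0 := Tj_gt0 d0 T0 K0 q0 s20 j.
have x0 := xphase_gt0 d0 T0 K0 q0 s20 j.
have e0 := epshat_gt0 d0 T0 K0 q0 s20 j.
have rate := deviation_rate_le x0 t0 (Tj_ge d0 T0 K0 q0 s20 j).
pose u : R := ((tj j)%:R * eps j ^+ 2)^-1.
have u0 : 0 <= u by rewrite invr_ge0 mulr_ge0 ?sqr_ge0.
have ue : u <= Num.min 1 (x j) / 8.
  move: rate; rewrite (_ : 8 / x j = eps j ^+ 2)//.
  rewrite /xphase invf_div mulrC divfK ?gt_eqF//.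
have nd : (tj j <= d * tj j)%N by rewrite leq_pmull.
apply: (@le_trans _ _ (2 ^+ K * u ^+ (K.-1./2).+1)%:E); last first.
  by rewrite lee_fin median_rate_le.
apply: median_failure_le => //.
- by move=> t; exact: mtheta.
- exact: coordinate_indep.
- move=> t1; apply: (@deviation_le _ _ _ P (X i) _ _ _ _ 1) => //.
  + by move=> t; exact: mtheta.
  + exact: coordinate_indep.
  + by move=> t; exact: btheta.
  + by move=> t; exact: Etheta.
  + by move=> t; exact: Vtheta.
Qed.

(** Phases before the last suffice: an estimate influences an action only after its phase has ended
    within the horizon. *)
Definition failure : set Omega :=
  \big[setU/set0]_(1 <= j < J) \big[setU/set0]_(i < d) coordinate_failure j i.

Lemma measurable_failure : measurable failure.
Proof.
apply: bigsetU_measurable => j _; apply: bigsetU_measurable => i _.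
exact: measurable_coordinate_failure.
Qed.

Lemma failure_le : (P failure <=
  (d%:R * (2 ^+ (K.-1./2).+1)^-1 * (4 * ln (1 + 2 * T%:R)))%:E)%E.
Proof.
set r : R := (2 ^+ (K.-1./2).+1)^-1; have r0 : 0 <= r by rewrite invr_ge0 exprn_ge0.
apply: (@le_trans _ _ (\sum_(1 <= j < J) (d%:R * (Num.min 1 (x j) * r)))%:E).
  apply: probability_bigsetU_le => j _.
    by apply: bigsetU_measurable => i _; exact: measurable_coordinate_failure.
  apply: (@le_trans _ _ (\sum_(i < d) (Num.min 1 (x j) * r))%:E).
    apply: probability_bigsetU_le => i _; first exact: measurable_coordinate_failure.
    exact: coordinate_failure_le.
  by rewrite lee_fin sumr_const card_ord -[leLHS]mulr_natl.
rewrite lee_fin -mulr_sumr -mulr_suml [_ * r]mulrC mulrA ler_wpM2l ?mulr_ge0//.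
exact: sum_min1_before_last.
Qed.

Lemma thetahatE w j i : thetahat T delta q s2 (fun t k => theta t k w) j i =
  median [seq blockmean (X i) (start j + i * tj j + l * (d * tj j)) (tj j) w | l <- iota 0 K].
Proof.
rewrite /thetahat; congr median; apply: eq_map => l; rewrite /mean_est /blockmean.
congr (_ * _); apply: eq_bigr => r _; rewrite /reward dotv_basis /X.
by congr (theta _ i w); lia.
Qed.

(** Coordinatewise errors of at most eps_j sqrt Sigma_ii combine, by monotonicity of the norm, to
    eps_j sigma_q. *)
Lemma not_failure_lpnorm_le w j : ~ failure w ->
  (0 < j)%N -> (start j.+1 < T)%N ->
  lpnorm q (fun i => thetastar i - thetahat T delta q s2 (fun t k => theta t k w) j i) <=
  alpha d T delta q s2 * Num.sqrt s2 * Num.sqrt (N j).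
Proof.
move=> nfail j0 jT.
have jJ : (j < J)%N.
  rewrite ltnNge; apply/negP => Jj.
  have [_ _ TJ] := lastphaseP d0 T0 K0 q0 s20.
  have := @phase_start_mono R d T delta q s2 J.+1 j.+1 isT Jj.
  by lia.
have nf i : ~ coordinate_failure j i w.
  move=> f; apply: nfail; rewrite /failure (big_rem j) ?mem_index_iota ?j0//=.
  by left; rewrite (bigD1 i)//=; left.
have e0 := ltW (epshat_gt0 d0 T0 K0 q0 s20 j).
apply: (@le_trans _ _ (lpnorm q (fun i => eps j * Num.sqrt (Sigma i i)))).
  apply: ler_lpnorm => // i; rewrite distrC (ger0_norm (mulr_ge0 e0 (sqrtr_ge0 _))).
  by rewrite thetahatE; exact: (median_failureP K0 (nf i)).
rewrite lpnormZ// lpnorm_sqrt_diag//; last exact: Sigma_diag_ge0.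
by rewrite ger0_norm// /epshat mulrAC.
Qed.

End GoodEvent.

(** * Bookkeeping of the constants *)

Section FinalArithmetic.
Context {R : realType}.
Implicit Types D L M A Q S K Lam : R.

(** The left side is at most 8 delta ^ 2 / (D L), where delta <= 1/2 absorbs one factor delta and D
    L >= 2 the rest. *)
Lemma failure_arith D L M A (delta : R) : 1 <= D -> 2 <= L -> 0 < delta -> delta <= 2^-1 ->
  (D * L / delta) ^+ 2 <= M -> 0 <= A -> A <= 2 * L ->
  D * M^-1 * (4 * A) <= 2 * delta.
Proof.
move=> D1 L2 de0 de1 yM A0 AL.
have D0 : 0 < D by rewrite (lt_le_trans _ D1).
have L0 : 0 < L by rewrite (lt_le_trans _ L2).
have y0 : 0 < (D * L / delta) ^+ 2 by rewrite exprn_gt0// divr_gt0// mulr_gt0.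
apply: (@le_trans _ _ (D * ((D * L / delta) ^+ 2)^-1 * (4 * (2 * L)))).
  apply: ler_pM; rewrite ?mulr_ge0 ?invr_ge0//; rewrite ?(ltW D0) ?(le_trans (ltW y0))//.
    by rewrite ler_wpM2l ?(ltW D0)// lef_pV2 ?posrE// (lt_le_trans y0).
  by rewrite ler_wpM2l.
rewrite (_ : D * ((D * L / delta) ^+ 2)^-1 * (4 * (2 * L)) = 8 * delta ^+ 2 / (D * L)); last first.
  by field; rewrite !gt_eqF.
rewrite ler_pdivrMr ?mulr_gt0//.
have DL : 2 <= D * L by rewrite -[2]mul1r ler_pM.
rewrite -mulrA.
have : delta ^+ 2 <= delta * 2^-1 by rewrite expr2 ler_wpM2l// ltW.
have : delta * 2 <= delta * (D * L) by rewrite ler_wpM2l// ltW.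
move: (delta * (D * L)) (delta ^+ 2) => u v; lra.
Qed.

Lemma regret_arith K D Lam Q S A : K <= 8 * Lam -> 0 <= D -> 0 <= S -> 1 <= Lam ->
  Q <= 4 * Lam * S -> A <= 2 * (Lam - 1) -> 0 <= A ->
  16 * (K * D) + Q * (256 * A + 73) <= 2048 * Lam ^+ 2 * (D + S).
Proof.
move=> KL D0 S0 L1 QS AL A0.
have L0 : 0 <= Lam by rewrite (le_trans _ L1).
have h1 : K * D <= 8 * (Lam ^+ 2 * D).
  rewrite mulrA ler_wpM2r//; apply: (le_trans KL).
  by rewrite ler_wpM2l// expr2 ler_peMl.
have A512 : 256 * A + 73 <= 512 * Lam by move: AL; clear; lra.
have A73 : 0 <= 256 * A + 73 by move: A0; clear; lra.
have h2 : Q * (256 * A + 73) <= 2048 * (Lam ^+ 2 * S).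
  rewrite (_ : 2048 * (Lam ^+ 2 * S) = 4 * Lam * S * (512 * Lam)); last by ring.
  by apply: (le_trans (ler_wpM2r A73 QS)); rewrite ler_wpM2l// mulr_ge0// mulr_ge0.
have h3 : 0 <= Lam ^+ 2 * D by rewrite mulr_ge0// sqr_ge0.
rewrite -[leRHS]mulrA [X in _ <= _ * X]mulrDr; move: h1 h2 h3.
move: (K * D) (Lam ^+ 2 * D) (Lam ^+ 2 * S) (Q * _); clear => ? ? ? ?; lra.
Qed.

Lemma short_arith (t : R) D Lam S : t <= 32 -> 1 <= D -> 0 <= S -> 1 <= Lam ->
  t <= 2048 * Lam ^+ 2 * (D + S).
Proof.
move=> t32 D1 S0 L1; apply: (le_trans t32).
have L21 : 1 <= Lam ^+ 2 by rewrite exprn_ege1.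
have DS : 1 <= D + S by rewrite (le_trans D1)// lerDl.
have : 1 <= Lam ^+ 2 * (D + S) by rewrite -[leLHS]mulr1 ler_pM.
by rewrite -mulrA; move: (Lam ^+ 2 * (D + S)); clear => z; lra.
Qed.

Lemma sqrt_arith K B (lam Lam : R) : 0 <= B -> 2^-1 <= lam -> 1 <= Lam -> K <= 8 * Lam ->
  Num.sqrt (K * B) <= 4 * Lam * Num.sqrt (lam * B).
Proof.
move=> B0 l1 L1 KL; have L0 : 0 <= Lam by rewrite (le_trans _ L1).
have l0 : 0 <= lam by rewrite (le_trans _ l1)// invr_ge0.
rewrite -[4 * Lam]ger0_norm ?mulr_ge0// -sqrtr_sqr -sqrtrM ?sqr_ge0//.
rewrite ler_sqrt ?mulr_ge0// ?sqr_ge0// mulrA ler_wpM2r//.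
apply: (le_trans KL); rewrite exprMn.
have LL : Lam <= Lam ^+ 2 by rewrite expr2 ler_peMl.
have h : Lam ^+ 2 * 2^-1 <= Lam ^+ 2 * lam by rewrite ler_wpM2l ?sqr_ge0.
rewrite (_ : 4 ^+ 2 * Lam ^+ 2 * lam = 16 * (Lam ^+ 2 * lam)); last by ring.
by move: LL h; move: (Lam ^+ 2 * lam) (Lam ^+ 2); clear => u v; lra.
Qed.

End FinalArithmetic.

(** * Case split on [delta] and [T], and assembly of the bound *)

Theorem theorem3p7 :
  exists C k : nat,
  forall (R : realType) (dO : measure_display) (Omega : measurableType dO)
    (P : probability Omega R) (d T : nat) (p q delta : R)
    (theta : nat -> 'I_d -> Omega -> R) (thetastar : 'I_d -> R)
    (Sigma : 'M[R]_d),
    (0 < d)%N ->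
    1 < p <= 2 -> p^-1 + q^-1 = 1 ->
    0 < delta < 1 ->
    (forall t i, measurable_fun setT (theta t i)) ->
    iid_vectors P theta ->
    (forall t i, ('E_P[theta t i] = (thetastar i)%:E)%E) ->
    (forall t i j, covariance P (theta t i) (theta t j) = (Sigma i j)%:E) ->
    (forall t (a : 'I_d -> R), lpnorm p a <= 1 ->
       {ae P, forall w, `|dotv a (fun i => theta t i w)| <= 1}) ->
    0 < sigma_q2 q Sigma ->
    forall astar : 'I_d -> R,
      lpnorm p astar <= 1 ->
      (forall a : 'I_d -> R, lpnorm p a <= 1 ->
         dotv a thetastar <= dotv astar thetastar) ->
      exists E : set Omega,
        [/\ measurable E, ((1 - 2 * delta)%:E <= P E)%E &
          forall w, E w ->
            @valee_regret R d T delta q (sigma_q2 q Sigma)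
              (fun t i => theta t i w) astar thetastar
            <= C%:R * (1 + ln d%:R + ln T%:R + ln delta^-1) ^+ k
                 * (d%:R + Num.sqrt (d%:R * T%:R * q * ln delta^-1
                                     * sigma_q2 q Sigma))].
Proof.
(* As in [regret_arith]: 2048 is 4 * 512, and the two factors [Lam] come from [sqrt_arith] and from
   the sum over phases. *)
exists 2048%N, 2%N.
move=> R dO Omega P d T p q delta theta thetastar Sigma d0 /andP[p1 p2] pq /andP[de0 de1]
  mth iid Eth Vth bth s20 astar astar1 opt.
have p0 : 0 < p by rewrite (lt_trans _ p1).
have qV : q^-1 = 1 - p^-1 by rewrite -pq addrC addKr.
have qV0 : 0 < q^-1 by rewrite qV subr_gt0 invf_lt1.
have q0 : 0 < q by rewrite -invr_gt0.
have q2 : 2 <= q.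
  have h : 2^-1 <= p^-1 by rewrite lef_pV2 ?posrE.
  rewrite -[leLHS]invrK -[leRHS]invrK lef_pV2 ?posrE ?invr_gt0// qV.
  by move: h; move: (p^-1); clear => z; lra.
have q1 : 1 < q by rewrite (lt_le_trans _ q2)// ltr1n.
have bcoord t i : {ae P, forall w, `|theta t i w| <= 1}.
  have := bth t (@Defs.basis R d i); rewrite lpnorm_basis ?gt_eqF// => /(_ (lexx _)).
  by apply: filterS => w; rewrite dotv_basis.
have L1 t i : theta t i \in Lfun P 1.
  apply: Lfun_subset12; first exact: fin_num_measure.
  exact: Lfun2_ae_bounded (mth t i) (bcoord t i).
(* The dual action of the mean attains its norm, which is thus the expectation of a reward bounded
   by 1. *)
have ts1 : lpnorm q thetastar <= 1.
  have [->//|ts0] := eqVneq (lpnorm q thetastar) 0.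
  rewrite -(dotv_exploit_action q1 ts0).
  have a1 : lpnorm p (exploit_action q thetastar) <= 1.
    by rewrite (lpnorm_exploit_action q1 pq ts0).
  have [_ Ea] := expectation_lincomb (index_enum 'I_d) (exploit_action q thetastar)
    (L1 0%N) (Eth 0%N).
  apply: (expectation_ae_le1 (P := P) _ (bth 0%N _ a1) Ea).
  apply: measurable_sum => i; apply: measurable_funM => //; exact: mth.
set s2 := sigma_q2 q Sigma in s20 *.
set Lam := 1 + ln d%:R + ln T%:R + ln delta^-1.
set S := Num.sqrt _.
have S0 : 0 <= S by exact: sqrtr_ge0.
have ld0 : 0 <= ln d%:R :> R by rewrite ln_ge0// ler1n.
have lT0 : 0 <= ln T%:R :> R.
  by have [T0|T0] := posnP T; [rewrite T0 ln0|rewrite ln_ge0// ler1n].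
have lde0 : 0 <= ln delta^-1 by rewrite ln_ge0// invf_ge1// ltW.
have Lam1 : 1 <= Lam.
  by rewrite /Lam -!addrA lerDl !addr_ge0.
have dR1 : 1 <= d%:R :> R by rewrite ler1n.
(* For delta >= 1/2 the required probability is at most 0, and the empty event will do. *)
have [de12|de12] := lerP 2^-1 delta.
  exists set0; split => //; rewrite measure0 lee_fin subr_le0.
  by rewrite -ler_pdivrMl// mulr1.
(* Below 16 the crude bound 2 T <= 32 is enough; from 16 = 2 ^ 4 on, ln T >= 2, as [failure_arith]
   requires. *)
have [T16|T16] := ltnP T 16.
  exists setT; split => //.
    by rewrite probability_setT lee_fin gerBl mulr_ge0// ltW.
  move=> w _.
  have := valee_regret_le2T T delta s2 (fun t i => theta t i w) d0 q2 pq astar1 ts1.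
  move/le_trans; apply.
  apply: short_arith => //.
  have T16' : T%:R <= 16 :> R by rewrite ler_nat ltnW.
  by rewrite (le_trans (ler_wpM2l _ T16'))// -natrM ler_nat.
have T0 : (0 < T)%N by rewrite (leq_trans _ T16).
have TR16 : 16 <= T%:R :> R by rewrite ler_nat.
have lT2 : 2 <= ln T%:R :> R.
  have h16 : ln (16 : R) <= ln T%:R.
    by rewrite ler_ln ?posrE// (lt_le_trans _ TR16).
  apply: le_trans h16; rewrite (_ : 16 = 2 ^+ 4); last by ring.
  rewrite lnXn// -[ln 2 *+ 4]mulr_natl; move: (@ln2_ge_half R); move: (ln (2 : R)).
  by clear => z; lra.
have lT1 : 1 <= ln T%:R :> R by rewrite (le_trans _ lT2)// ler1n.
have dR0 : 0 < d%:R :> R by rewrite ltr0n.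
have lTgt0 : 0 < ln T%:R :> R by rewrite (lt_le_trans _ lT1).
pose y : R := d%:R * ln T%:R / delta.
have ly0 : 0 < ln y.
  rewrite ln_gt0// /y ltr_pdivlMr// mul1r (lt_le_trans de1)//.
  exact: mulr_ege1.
have y0 : 0 < y by rewrite /y divr_gt0// mulr_gt0.
have [Kge Klt] := nat_ceil_itv (ltW (mulr_gt0 (ltr0Sn R 7) ly0)).
have K0 : (0 < kappa d T delta)%N by apply: nat_ceil_gt0; rewrite mulr_gt0.
rewrite -/(kappa d T delta) in Kge Klt.
have lA0 : 0 <= ln (1 + 2 * T%:R) :> R by rewrite ln_ge0// lerDl mulr_ge0.
have lA : ln (1 + 2 * T%:R) <= 2 * ln T%:R :> R.
  have TR0 : 0 < T%:R :> R by rewrite ltr0n.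
  rewrite [leRHS]mulr_natl -lnXn// ler_ln ?posrE ?exprn_gt0// ?addr_gt0 ?mulr_gt0//.
  by move: TR16; move: (T%:R : R); clear => z; nra.
(* [kappa] involves ln T inside a logarithm, and ln (ln T) <= ln T brings it below [Lam]; the
   rounding up is absorbed by the 1 in [Lam]. *)
have KL : (kappa d T delta)%:R <= 8 * Lam.
  have yE : ln y = ln d%:R + ln (ln T%:R) + ln delta^-1.
    by rewrite /y lnM ?posrE ?invr_gt0 ?mulr_gt0// lnM ?posrE.
  rewrite yE in Klt ly0.
  apply: (kappa_arith Klt (ltW ly0)).
  have h := ltW (ln_sublinear lTgt0).
  have -> : Lam - 1 = ln d%:R + ln T%:R + ln delta^-1.
    by rewrite /Lam; move: (ln _) (ln _) (ln _); clear => ? ? ?; ring.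
  by rewrite lerD2r lerD2l.
pose F := failure T q delta theta thetastar Sigma.
have mF : measurable F by exact: measurable_failure.
exists (~` F); split; first exact: measurableC.
  rewrite probability_setC// EFinB leeB//.
  have Vd t i : covariance P (theta t i) (theta t i) = (Sigma i i)%:E by exact: Vth.
  apply: (le_trans (failure_le mth iid Eth Vd bcoord d0 T0 K0 q0 s20)).
  rewrite lee_fin; apply: (@failure_arith R d%:R (ln T%:R)) => //; first exact: ltW.
  exact: pow2_ge_sqr.
move=> w nF.
have Vd t i : covariance P (theta t i) (theta t i) = (Sigma i i)%:E by exact: Vth.
have good j : (0 < j)%N -> _ := not_failure_lpnorm_le Vd d0 T0 K0 q0 s20 nF.
apply: (le_trans (valee_regret_good_le d0 q2 pq astar1 ts1 T0 K0 s20 good)).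
have -> : d%:R * (kappa d T delta)%:R * T%:R * q * s2 =
    (kappa d T delta)%:R * (d%:R * T%:R * q * s2) :> R by rewrite [d%:R * _]mulrC -!mulrA.
have SE : S = Num.sqrt (ln delta^-1 * (d%:R * T%:R * q * s2)).
  rewrite /S; congr Num.sqrt.
  by rewrite [LHS]mulrAC mulrC.
have lde : 2^-1 <= ln delta^-1.
  apply: (le_trans (@ln2_ge_half R)); rewrite ler_ln ?posrE ?invr_gt0//.
  by rewrite -[leLHS]invrK lef_pV2 ?posrE ?invr_gt0// ltW.
apply: regret_arith => //.
- by rewrite SE; apply: sqrt_arith => //; rewrite !mulr_ge0// ltW.
- apply: (le_trans lA); rewrite ler_wpM2l// /Lam.
  by move: ld0 lde0; move: (ln _) (ln _) (ln _); clear => ? ? ?; lra.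
Qed.
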